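(* Let $(\mathbf{A},\mathbf{B})$ be a finite template for which the decision problem $\mathrm{PCSP}(\mathbf{A},\mathbf{B})$ has a polynomial-time solution, and suppose that $\mathrm{NP}\neq\mathrm{coNP}$. Then the search problem $\mathrm{sPCSP}(\mathbf{A},\mathbf{B})$ is not FNP-hard. In particular, if $\mathrm{sPCSP}(\mathbf{A},\mathbf{B})$ has no polynomial-time solution, then it is FNP-intermediate.
   Context: A finite template is a pair $(\mathbf{A},\mathbf{B})$ of finite relational structures of the same signature with a homomorphism $\mathbf{A}\to\mathbf{B}$. $\mathrm{PCSP}(\mathbf{A},\mathbf{B})$: given a finite structure $\mathbf{I}$, accept if $\mathbf{I}\to\mathbf{A}$ and reject if $\mathbf{I}\not\to\mathbf{B}$ (no requirement otherwise). $\mathrm{sPCSP}(\mathbf{A},\mathbf{B})$: given finite $\mathbf{I}$, output a homomorphism $\mathbf{I}\to\mathbf{B}$ if $\mathbf{I}\to\mathbf{A}$, and reject if $\mathbf{I}\not\to\mathbf{B}$. FNP-hardness is with respect to generalized many-one reductions: a pair $(\alpha,\beta)$ of polynomial-time maps such that whenever $\mathbf{z}$ is a valid answer (possibly the rejection symbol) to $\alpha(\mathbf{x})$ in the target problem, $\beta(\mathbf{x},\mathbf{z})$ is a valid answer (possibly rejection) to $\mathbf{x}$ in the source problem. FNP-intermediate means in FNP, not solvable in polynomial time, and not FNP-hard. *)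

(* Defs.v *)
From HB Require Import structures.
From Stdlib Require Import FunctionalExtensionality.
From mathcomp Require Import all_boot all_order all_algebra.

Set Implicit Arguments.
Unset Strict Implicit.
Unset Printing Implicit Defensive.

Notation bits := (seq bool).

(** * Deterministic multi-tape Turing machines

    The tape symbols are the two bits and the blank [None].  A tape is
    infinite in both directions: [(l, r)] lists the cells strictly to the left
    of the head (nearest first) and the cells from the head rightwards; cells
    beyond the lists are blank. *)

Definition tape : Type := (seq (option bool) * seq (option bool))%type.

Inductive move := Left | Stay | Right.

Definition tape_read (t : tape) : option bool := head None t.2.

Definition tape_act (a : option bool * move) (t : tape) : tape :=
  let: (l, r) := (t.1, behead t.2) in
  match a.2 with
  | Left => (behead l, [:: head None l, a.1 & r])
  | Stay => (l, a.1 :: r)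
  | Right => (a.1 :: l, r)
  end.

Record machine := Machine {
  ntapes : nat;
  state : finType;
  start : state;
  halting : pred state;
  trans : state -> {ffun 'I_ntapes.+1 -> option bool} ->
          state * {ffun 'I_ntapes.+1 -> option bool * move}
}.

Definition config (M : machine) : Type :=
  (state M * {ffun 'I_(ntapes M).+1 -> tape})%type.

Definition step (M : machine) (c : config M) : config M :=
  if halting c.1 then c else
  let: (q, a) := trans c.1 [ffun i => tape_read (c.2 i)] in
  (q, [ffun i => tape_act (a i) (c.2 i)]).

(* The i-th input is written on the i-th tape, starting under the head; all
   other tapes are blank. *)
Definition init (M : machine) (xs : seq bits) : config M :=
  (start M, [ffun i : 'I_(ntapes M).+1 => ([::], map Some (nth [::] xs i))]).

Fixpoint bits_before_blank (s : seq (option bool)) : bits :=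
  if s is Some b :: s' then b :: bits_before_blank s' else [::].

(* The output is read on tape 0, from the head to the first blank. *)
Definition output (M : machine) (c : config M) : bits :=
  bits_before_blank (c.2 ord0).2.

Definition computes_within (M : machine) (xs : seq bits) (y : bits) (t : nat) :=
  exists n, [/\ n <= t, halting (iter n (@step M) (init M xs)).1
              & output (iter n (@step M) (init M xs)) = y].

(** * Polynomial time *)

(* [polytime inp out]: one machine, on the input strings [inp x], outputs
   [out x], in time polynomial in the total input length, for every [x : X].
   Thus [X] together with [inp] is the set of legal inputs; nothing is required
   of the machine on other strings. *)
Definition polytime (X : Type) (inp : X -> seq bits) (out : X -> bits) : Prop :=
  exists (M : machine) (p : {poly nat}), forall x : X,
    computes_within M (inp x) (out x) p.[sumn (map size (inp x))]%R.

Definition enc_bool (b : bool) : bits := [:: b].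

Definition enc_option (z : option bits) : bits :=
  if z is Some y then true :: y else [:: false].

(** * NP and coNP *)

Definition language := bits -> Prop.

Definition inNP (L : language) : Prop :=
  exists (V : bits -> bits -> bool) (p : {poly nat}),
    polytime (fun xy : bits * bits => [:: xy.1; xy.2])
             (fun xy => enc_bool (V xy.1 xy.2)) /\
    forall x, L x <-> exists y, size y <= p.[size x]%R /\ V x y.

Definition incoNP (L : language) : Prop := inNP (fun x => ~ L x).

Definition NP_neq_coNP : Prop := ~ (forall L, inNP L <-> incoNP L).

(** * Search problems and FNP *)

(* On instance [x], a solution must be found if [promise x] holds, and [x] must
   be rejected if it has no solution.  An ordinary search problem is the case
   where [promise x] says that [x] has a solution. *)
Record search_problem := SearchProblem {
  instance : Type;
  enc : instance -> bits;
  enc_inj : injective enc;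
  promise : instance -> Prop;
  solution : instance -> bits -> Prop;
  promise_solvable : forall x, promise x -> exists y, solution x y
}.

(* The answer [None] is the rejection symbol. *)
Definition valid (S : search_problem) (x : instance S) (z : option bits) :=
  (promise x -> exists2 y, z = Some y & solution x y) /\
  ((forall y, ~ solution x y) -> z = None).

Definition polytime_solvable (S : search_problem) : Prop :=
  exists f : instance S -> option bits,
    polytime (fun x => [:: enc x]) (fun x => enc_option (f x)) /\
    forall x, valid x (f x).

Definition inFNP (S : search_problem) : Prop :=
  exists (V : instance S -> bits -> bool) (p : {poly nat}),
    polytime (fun xy : instance S * bits => [:: enc xy.1; xy.2])
             (fun xy => enc_bool (V xy.1 xy.2)) /\
    forall x y, solution x y <-> size y <= p.[size (enc x)]%R /\ V x y.

Definition reduces (S T : search_problem) : Prop :=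
  exists (alpha : instance S -> instance T)
         (beta : instance S -> option bits -> option bits),
    [/\ polytime (fun x => [:: enc x]) (fun x => enc (alpha x)),
        polytime (fun xz : instance S * option bits =>
                    [:: enc xz.1; enc_option xz.2])
                 (fun xz => enc_option (beta xz.1 xz.2))
      & forall x z, valid (alpha x) z -> valid x (beta x z)].

Definition FNP_hard (T : search_problem) : Prop :=
  forall S, inFNP S -> reduces S T.

Definition FNP_intermediate (S : search_problem) : Prop :=
  [/\ inFNP S, ~ polytime_solvable S & ~ FNP_hard S].

(** * Finite relational structures *)

Record signature := Signature {
  symbol : finType;
  arity : symbol -> nat
}.

Record structure (sigma : signature) := Structure {
  dom : finType;
  rel : forall s : symbol sigma, {set (arity s).-tuple dom}
}.

Definition is_hom (sigma : signature) (A B : structure sigma)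
    (h : dom A -> dom B) : Prop :=
  forall (s : symbol sigma) (t : (arity s).-tuple (dom A)),
    t \in rel A s -> map_tuple h t \in rel B s.

Definition hom_to (sigma : signature) (A B : structure sigma) : Prop :=
  exists h : dom A -> dom B, is_hom h.

Record template (sigma : signature) := Template {
  tA : structure sigma;
  tB : structure sigma;
  tAB : hom_to tA tB
}.

(* To be written as strings, input structures have domain {0, ..., n-1}. *)
Record input (sigma : signature) := Input {
  isize : nat;
  irel : forall s : symbol sigma, {set (arity s).-tuple 'I_isize}
}.

Coercion input_structure (sigma : signature) (I : input sigma) :
  structure sigma := @Structure sigma 'I_(isize I) (@irel sigma I).

(** ** Encodings *)

Definition unary (n : nat) : bits := rcons (nseq n true) false.

Definition enc_ords (n : nat) (t : seq 'I_n) : bits :=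
  flatten [seq unary i | i : 'I_n <- t].

(* A list of tuples of known common length: each is preceded by [true], and
   [false] marks the end. *)
Definition enc_tuples (n k : nat) (ts : seq (k.-tuple 'I_n)) : bits :=
  rcons (flatten [seq true :: enc_ords t | t : k.-tuple 'I_n <- ts]) false.

Definition enc_input (sigma : signature) (I : input sigma) : bits :=
  unary (isize I) ++
  flatten [seq enc_tuples (enum (irel I s)) | s <- enum (symbol sigma)].

(* The values h 0, ..., h (n-1), each given by its rank in the domain of B. *)
Definition enc_hom (sigma : signature) (I : input sigma) (B : structure sigma)
    (h : dom I -> dom B) : bits :=
  enc_ords [seq enum_rank (h i) | i <- enum (dom I)].

Lemma unary_cat_inj m n s t : unary m ++ s = unary n ++ t -> m = n /\ s = t.
Proof.
rewrite /unary; elim: m n => [|m IH] [|n] //=; first by case.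
by case=> /IH [-> ->].
Qed.

Lemma enc_ords_cat_inj n (t u : seq 'I_n) s s' : size t = size u ->
  enc_ords t ++ s = enc_ords u ++ s' -> t = u /\ s = s'.
Proof.
elim: t u => [|i t IH] [|j u] //= [szE].
rewrite /enc_ords /= -!catA => /unary_cat_inj [/val_inj -> /(IH _ szE)].
by case=> -> ->.
Qed.

Lemma enc_tuples_cat_inj n k (ts us : seq (k.-tuple 'I_n)) s s' :
  enc_tuples ts ++ s = enc_tuples us ++ s' -> ts = us /\ s = s'.
Proof.
rewrite /enc_tuples !cat_rcons.
elim: ts us => [|t ts IH] [|u us] //=; first by case.
rewrite -!catA; case=> /enc_ords_cat_inj []; first by rewrite !size_tuple.
by move=> /val_inj -> /IH [-> ->].
Qed.

Lemma enc_input_inj (sigma : signature) : injective (@enc_input sigma).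
Proof.
move=> [n r] [m r'] /unary_cat_inj /= [nm]; case: m / nm r' => r' eq_r.
suff -> : r = r' by []; apply: functional_extensionality_dep => s.
have: s \in enum (symbol sigma) by rewrite mem_enum.
elim: (enum (symbol sigma)) eq_r => [|s' ss IH] //= /enc_tuples_cat_inj.
case=> eq_s /IH {}IH; rewrite inE => /orP [/eqP ->|//].
by apply/setP => t; rewrite -mem_enum eq_s mem_enum.
Qed.

(** * PCSP and its search version *)

Definition PCSP_polytime (sigma : signature) (T : template sigma) : Prop :=
  exists f : input sigma -> bool,
    polytime (fun I => [:: enc_input I]) (fun I => enc_bool (f I)) /\
    forall I : input sigma,
      (hom_to I (tA T) -> f I = true) /\ (~ hom_to I (tB T) -> f I = false).

Definition sPCSP_solution (sigma : signature) (T : template sigma)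
    (I : input sigma) (y : bits) : Prop :=
  exists2 h : dom I -> dom (tB T), is_hom h & y = enc_hom h.

Lemma sPCSP_promise_solvable (sigma : signature) (T : template sigma)
    (I : input sigma) :
  hom_to I (tA T) -> exists y, sPCSP_solution T I y.
Proof.
case=> h hh; case: (tAB T) => g hg; exists (enc_hom (g \o h)), (g \o h) => //.
move=> s t /hh /hg; suff -> : map_tuple (g \o h) t =
  map_tuple g (map_tuple h t) by [].
by apply: val_inj; rewrite /= map_comp.
Qed.

Definition sPCSP (sigma : signature) (T : template sigma) : search_problem :=
  SearchProblem (@enc_input_inj sigma) (@sPCSP_promise_solvable sigma T).

(* Main.v *)
(** Suppose that sPCSP(A, B) is FNP-hard and let L be in NP.  Reduce the search
    for NP-witnesses of L to sPCSP(A, B) by (alpha, beta).  A certificate for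
    x \notin L is a valid answer z to alpha(x) with beta(x, z) = rejection: as
    soon as z is valid, this rejection is correct, and every x has such a z that
    can be verified in polynomial time, namely a homomorphism
    alpha(x) -> B if there is one, and otherwise the rejection symbol, whose
    validity is witnessed by the polynomial-time algorithm for PCSP(A, B)
    answering "no".  Hence NP = coNP. *)

From Stdlib Require Import FunctionalExtensionality Classical.
From mathcomp Require Import all_boot all_algebra zify.
Require Import Defs.

Set Implicit Arguments.
Unset Strict Implicit.
Unset Printing Implicit Defensive.

(** * Tapes as pairs of streams *)

(* Unlike [tape], this representation of a tape does not depend on trailing
   blanks, so that equal tapes are equal terms. *)
Definition stream := nat -> option bool.
Definition blank : stream := fun=> None.
Definition scons (a : option bool) (r : stream) : stream :=
  fun i => if i is j.+1 then r j else a.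
Definition stail (r : stream) : stream := fun i => r i.+1.
Definition sprefix (s : bits) (r : stream) : stream :=
  foldr (fun b => scons (Some b)) r s.

Definition stape : Type := (stream * stream)%type.
Definition stape_read (t : stape) : option bool := t.2 0.
Definition stape_act (a : option bool * move) (t : stape) : stape :=
  match a.2 with
  | Left => (stail t.1, scons (t.1 0) (scons a.1 (stail t.2)))
  | Stay => (t.1, scons a.1 (stail t.2))
  | Right => (scons a.1 t.1, stail t.2)
  end.

Definition tape_stream (t : tape) : stape := (nth None t.1, nth None t.2).
Definition stack (s : bits) : stape := (blank, sprefix s blank).

(* The cells beyond the first blank are unconstrained, as is the left half. *)
Definition shows (t : stape) (s : bits) : Prop :=
  exists2 r, r 0 = None & t.2 = sprefix s r.

Lemma scons_stail r : scons (r 0) (stail r) = r.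
Proof. by apply: functional_extensionality => -[]. Qed.

Lemma stail_scons a r : stail (scons a r) = r.
Proof. by []. Qed.

Lemma scons_blank : scons None blank = blank.
Proof. by apply: functional_extensionality => -[]. Qed.

Lemma stape_act_read t : stape_act (stape_read t, Stay) t = t.
Proof. by case: t => l r; rewrite /stape_act /stape_read /= scons_stail. Qed.

Lemma stape_read_stack s : stape_read (stack s) = ohead s.
Proof. by case: s. Qed.

Lemma shows_stack s : shows (stack s) s.
Proof. by exists blank. Qed.

Lemma stape_read_tape_stream t : stape_read (tape_stream t) = tape_read t.
Proof. by rewrite /stape_read /tape_read /= nth0. Qed.

Lemma tape_stream_act a t :
  tape_stream (tape_act a t) = stape_act a (tape_stream t).
Proof.
have nth_tail s : nth None (behead s) = stail (nth None s).
  by apply: functional_extensionality => i; rewrite nth_behead.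
have nth_scons b s : nth None (b :: s) = scons b (nth None s).
  by apply: functional_extensionality => -[].
case: a t => a [] [l r]; rewrite /tape_act /stape_act /tape_stream /=;
  by rewrite ?nth_scons ?nth_tail -?nth0.
Qed.

Lemma tape_stream_stack s : tape_stream ([::], map Some s) = stack s.
Proof.
congr pair; apply: functional_extensionality => i; first exact: nth_nil.
by elim: s i => [|b s IH] [|i] //=; rewrite ?nth_nil ?IH.
Qed.

Lemma shows_tape_stream t : shows (tape_stream t) (bits_before_blank t.2).
Proof.
case: t => l r /=; elim: r => [|[b|] r [q q0 /= qE]].
- exists blank => //=; apply: functional_extensionality => i.
  by rewrite nth_nil.
- exists q => //=; rewrite -qE /=.
  by apply: functional_extensionality => -[].
- by exists (nth None (None :: r)).
Qed.

Lemma shows_bits_before_blank t s :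
  shows (tape_stream t) s -> bits_before_blank t.2 = s.
Proof.
case: t => l r [q q0 /=].
elim: s r => [|b s IH] [|[c|] r] //= rE;
  have := congr1 (fun f => f 0) rE => //=.
- by rewrite q0.
- case=> ->; rewrite (IH r) //; have := congr1 stail rE.
  by rewrite /= stail_scons => <-; apply: functional_extensionality.
Qed.

(** * Program fragments *)

(* A transition to [None] leaves the fragment. *)
Record frag (V : finType) := Frag {
  fstate : finType;
  fstart : fstate;
  ftrans : fstate -> (V -> option bool) ->
           option fstate * (V -> option bool * move)
}.

Section Fragments.

Variable V : finType.
Implicit Types (F G : frag V) (t u w : V -> stape).
Implicit Types (test : (V -> option bool) -> bool).

Definition reads t : V -> option bool := fun v => stape_read (t v).
Definition acts (a : V -> option bool * move) t : V -> stape :=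
  fun v => stape_act (a v) (t v).
Definition idle (r : V -> option bool) : V -> option bool * move :=
  fun v => (r v, Stay).

Lemma acts_idle t : acts (idle (reads t)) t = t.
Proof. by apply: functional_extensionality => v; apply: stape_act_read. Qed.

Inductive run F : fstate F -> (V -> stape) -> nat -> (V -> stape) -> Prop :=
| run_exit q t a : ftrans q (reads t) = (None, a) -> run q t 1 (acts a t)
| run_step q t a q' n u : ftrans q (reads t) = (Some q', a) ->
    run q' (acts a t) n u -> run q t n.+1 u.

Definition exec F t n u : Prop := exists2 m, m <= n & run (fstart F) t m u.

Lemma exec_leq F t u n m : n <= m -> exec F t n u -> exec F t m u.
Proof. by move=> le_nm [k le_kn r]; exists k => //; apply: leq_trans le_nm. Qed.

Lemma run_embed F G (phi : fstate F -> fstate G) :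
  (forall q r, ftrans (phi q) r = (omap phi (ftrans q r).1, (ftrans q r).2)) ->
  forall q t n u, run q t n u -> run (phi q) t n u.
Proof.
move=> phiE q t n u; elim=> [{}q {}t a tr_q|{}q {}t a q' k {}u tr_q _ IH].
  by apply: run_exit; rewrite phiE tr_q.
by apply: run_step IH; rewrite phiE tr_q.
Qed.

Lemma run_embed_then F G (phi : fstate F -> fstate G) q1 :
  (forall q r,
     ftrans (phi q) r = (Some (oapp phi q1 (ftrans q r).1), (ftrans q r).2)) ->
  forall q t n u m w,
    run q t n u -> run q1 u m w -> run (phi q) t (n + m) w.
Proof.
move=> phiE q t n u m w.
elim=> [{}q {}t a tr_q|{}q {}t a q' k {}u tr_q _ IH] run_w.
  by apply: run_step run_w; rewrite phiE tr_q.
by apply: run_step (IH run_w); rewrite phiE tr_q.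
Qed.

Definition fseq F G : frag V :=
  @Frag V (fstate F + fstate G)%type (inl (fstart F)) (fun q r =>
    match q with
    | inl q => (Some (oapp inl (inr (fstart G)) (ftrans q r).1), (ftrans q r).2)
    | inr q => (omap inr (ftrans q r).1, (ftrans q r).2)
    end).

Lemma exec_seq F G t u w n m :
  exec F t n u -> exec G u m w -> exec (fseq F G) t (n + m) w.
Proof.
case=> n' le_n runF [m' le_m runG]; exists (n' + m'); first exact: leq_add.
apply: (@run_embed_then F (fseq F G) inl _ _ _ _ _ _ _ _ runF) => //.
exact: (@run_embed G (fseq F G) inr).
Qed.

Definition fif test F G : frag V :=
  @Frag V (option (fstate F + fstate G)) None (fun q r =>
    match q with
    | None => (Some (Some (if test r then inl (fstart F) else inr (fstart G))),
               idle r)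
    | Some (inl q) => (omap (Some \o inl) (ftrans q r).1, (ftrans q r).2)
    | Some (inr q) => (omap (Some \o inr) (ftrans q r).1, (ftrans q r).2)
    end).

Lemma exec_if test F G t n u :
  exec (if test (reads t) then F else G) t n u -> exec (fif test F G) t n.+1 u.
Proof.
case=> n' le_n run_u; exists n'.+1 => //.
apply: (@run_step (fif test F G) None t (idle (reads t))) => //=.
rewrite acts_idle; case: (test _) run_u => run_u.
- exact: (@run_embed F (fif test F G) (Some \o inl)).
- exact: (@run_embed G (fif test F G) (Some \o inr)).
Qed.

Definition fwhile test F : frag V :=
  @Frag V (option (fstate F)) None (fun q r =>
    match q with
    | None => (if test r then Some (Some (fstart F)) else None, idle r)
    | Some q => (Some (ftrans q r).1, (ftrans q r).2)
    end).

Lemma exec_while_done test F t :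
  test (reads t) = false -> exec (fwhile test F) t 1 t.
Proof.
move=> bN; exists 1 => //; rewrite -{2}(acts_idle t).
by apply: run_exit; rewrite /= bN.
Qed.

Lemma exec_while_more test F t n u m w :
  test (reads t) -> exec F t n u -> exec (fwhile test F) u m w ->
  exec (fwhile test F) t (n + m).+1 w.
Proof.
move=> bT [n' le_n runF] [m' le_m runW]; exists (n' + m').+1.
  by rewrite ltnS leq_add.
apply: (@run_step (fwhile test F) None t (idle (reads t)) (Some (fstart F))).
  by rewrite /= bT.
rewrite acts_idle.
apply: (@run_embed_then F (fwhile test F) Some _ _ _ _ _ _ _ _ runF runW).
by move=> q r /=; case: (ftrans q r).1.
Qed.

End Fragments.

(** * Stacks of bits *)

Inductive op := Keep | Pop | Push of bool.

Definition stape_op (o : op) (t : stape) : stape :=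
  match o with
  | Keep => t
  | Pop => (scons None t.1, stail t.2)
  | Push b => (stail t.1, scons (Some b) t.2)
  end.

Definition bits_op (o : op) (s : bits) : bits :=
  match o with Keep => s | Pop => behead s | Push b => b :: s end.

Lemma stape_op_stack o s : stape_op o (stack s) = stack (bits_op o s).
Proof.
by case: o s => [||b] [|c s] //=; rewrite /stack /= ?scons_blank.
Qed.

Lemma iter_pop_stack s : iter (size s) (stape_op Pop) (stack s) = stack [::].
Proof. by elim: s => // b s IH; rewrite iterSr stape_op_stack. Qed.

Definition push_all (t : stape) (s : bits) : stape :=
  foldl (fun t b => stape_op (Push b) t) t s.

Lemma push_all_stack q s : push_all (stack q) s = stack (catrev s q).
Proof.
by elim: s q => // b s IH q; rewrite /= -IH -(stape_op_stack (Push b)).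
Qed.

Section StackFragments.

Variable V : finType.
Implicit Types (F G : frag V) (t : V -> stape) (s : V -> bits).
Implicit Types (test : (V -> option bool) -> bool).

Definition stacks s : V -> stape := fun v => stack (s v).

Lemma reads_stacks s : reads (stacks s) = fun v => ohead (s v).
Proof. by apply: functional_extensionality => v; apply: stape_read_stack. Qed.

Definition sexec F s n s' : Prop := exec F (stacks s) n (stacks s').

Lemma sexec_if test F G s n s' :
  sexec (if test (fun v => ohead (s v)) then F else G) s n s' ->
  sexec (fif test F G) s n.+1 s'.
Proof. by rewrite -reads_stacks; apply: exec_if. Qed.

Lemma sexec_while_done test F s :
  test (fun v => ohead (s v)) = false -> sexec (fwhile test F) s 1 s.
Proof. by rewrite -reads_stacks; apply: exec_while_done. Qed.

Lemma sexec_while_more test F s n s1 m s2 :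
  test (fun v => ohead (s v)) -> sexec F s n s1 ->
  sexec (fwhile test F) s1 m s2 ->
  sexec (fwhile test F) s (n + m).+1 s2.
Proof. by rewrite -reads_stacks; apply: exec_while_more. Qed.

(* A push moves left in the first step and writes in the second. *)
Definition fops (o : V -> op) : frag V :=
  @Frag V bool false (fun q r =>
    if q then (None, fun v => if o v is Push b then (Some b, Stay)
                              else (r v, Stay))
    else (Some true, fun v => match o v with
                              | Keep => (r v, Stay)
                              | Pop => (None, Right)
                              | Push _ => (r v, Left)
                              end)).

Lemma exec_ops o t : exec (fops o) t 2 (fun v => stape_op (o v) (t v)).
Proof.
exists 2 => //; apply: (@run_step V (fops o) _ _ _ true) => [//|].
set u := acts _ t.
have -> : (fun v => stape_op (o v) (t v)) =
    acts (fun v => if o v is Push b then (Some b, Stay)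
                   else (reads u v, Stay)) u.
  apply: functional_extensionality => v; rewrite /u /acts /reads.
  case: (o v) => [||b]; rewrite ?stape_act_read //=.
  by rewrite /stape_act /= !stail_scons /stape_read scons_stail.
exact: run_exit.
Qed.

Lemma sexec_ops o s : sexec (fops o) s 2 (fun v => bits_op (o v) (s v)).
Proof.
rewrite /sexec; have -> : stacks (fun v => bits_op (o v) (s v)) =
    fun v => stape_op (o v) (stacks s v).
  by apply: functional_extensionality => v; rewrite stape_op_stack.
exact: exec_ops.
Qed.

Definition fskip : frag V := fops (fun=> Keep).

Lemma exec_skip t : exec fskip t 2 t.
Proof. exact: exec_ops. Qed.

(* [u] is popped up to its first blank; its bits are pushed on the tapes in
   [P], hence in reverse order. *)
Definition fmove (u : V) (P : pred V) : frag V :=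
  let body b := fops (fun v => if v == u then Pop else
                               if P v then Push b else Keep) in
  fwhile (fun r => r u != None)
         (fif (fun r => r u == Some true) (body true) (body false)).

Lemma exec_move u (P : pred V) t y : shows (t u) y ->
  exec (fmove u P) t (4 * size y + 1) (fun v =>
    if v == u then iter (size y) (stape_op Pop) (t v)
    else if P v then push_all (t v) y else t v).
Proof.
case=> r r0; elim: y t => [|b y IH] t tuE.
  rewrite (_ : (fun v => _) = t).
    by apply: exec_while_done; rewrite /reads /stape_read tuE /= r0.
  by apply: functional_extensionality => v; case: ifP => // _; case: ifP.
pose o v := if v == u then Pop else if P v then Push b else Keep.
rewrite (_ : (fun v => _) = fun v =>
    if v == u then iter (size y) (stape_op Pop) (stape_op (o v) (t v))
    else if P v then push_all (stape_op (o v) (t v)) y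
    else stape_op (o v) (t v)); last first.
  apply: functional_extensionality => v; rewrite /o.
  by case: eqP => _; [apply: iterSr | case: (P v)].
have -> : 4 * size (b :: y) + 1 = (3 + (4 * size y + 1)).+1 by rewrite /=; lia.
apply: exec_while_more (IH _ _); last by rewrite /o eqxx /= tuE stail_scons.
  by rewrite /reads /stape_read tuE.
apply: exec_if; rewrite /reads /stape_read tuE /=.
by rewrite /o; case: (b); apply: exec_ops.
Qed.

Lemma sexec_move u (P : pred V) s :
  sexec (fmove u P) s (4 * size (s u) + 1) (fun v =>
    if v == u then [::] else if P v then catrev (s u) (s v) else s v).
Proof.
rewrite /sexec; set s' := fun v : V => _.
rewrite (_ : stacks s' = fun v =>
    if v == u then iter (size (s u)) (stape_op Pop) (stacks s v)
    else if P v then push_all (stacks s v) (s u)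
    else stacks s v); first exact/exec_move/shows_stack.
apply: functional_extensionality => v; rewrite /stacks /s' push_all_stack.
by case: eqP => [->|_]; [rewrite iter_pop_stack | case: ifP].
Qed.

Definition upd s (v : V) (y : bits) : V -> bits :=
  fun u => if u == v then y else s u.

Definition fclear (u : V) : frag V := fmove u pred0.

Lemma sexec_clear u s : sexec (fclear u) s (4 * size (s u) + 1) (upd s u [::]).
Proof. exact: (sexec_move u pred0). Qed.

Definition fwrite (u : V) (y : bits) : frag V :=
  foldr (fun b F => fseq F (fops (fun v => if v == u then Push b else Keep)))
        (fclear u) y.

Lemma sexec_write u y s :
  sexec (fwrite u y) s (4 * size (s u) + 1 + 2 * size y) (upd s u y).
Proof.
elim: y => [|b y IH] /=; first by rewrite muln0 addn0; apply: sexec_clear.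
rewrite mulnS [2 + _]addnC addnA; apply: exec_seq IH _.
rewrite (_ : upd s u (b :: y) =
    fun v => bits_op (if v == u then Push b else Keep) (upd s u y v)).
  exact: sexec_ops.
by apply: functional_extensionality => v; rewrite /upd; case: ifP.
Qed.

Definition fcopy (tmp u w : V) : frag V :=
  fseq (fmove u (pred1 tmp)) (fmove tmp (pred2 u w)).

Lemma sexec_copy tmp u w s : uniq [:: tmp; u; w] ->
  s tmp = [::] -> s w = [::] ->
  sexec (fcopy tmp u w) s (8 * size (s u) + 2) (upd s w (s u)).
Proof.
rewrite /= !inE negb_or => /and3P [/andP [tu tw] uw _] s_tmp s_w.
set s1 := fun v => if v == u then [::] else
  if pred1 tmp v then catrev (s u) (s v) else s v.
have s1_tmp : s1 tmp = rev (s u) by rewrite /s1 (negbTE tu) /= eqxx s_tmp.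
have -> : 8 * size (s u) + 2 = 4 * size (s u) + 1 + (4 * size (s1 tmp) + 1).
  by rewrite s1_tmp size_rev; lia.
rewrite (_ : upd s w (s u) = fun v => if v == tmp then [::] else
    if pred2 u w v then catrev (s1 tmp) (s1 v) else s1 v).
  exact: exec_seq (sexec_move _ _ _) (sexec_move _ _ _).
apply: functional_extensionality => v; rewrite s1_tmp /upd /s1 /=.
rewrite catrevE revK.
case: (eqVneq v tmp) => [->|v_tmp]; first by rewrite (negbTE tw).
case: (eqVneq v w) => [->|v_w]; last first.
  by rewrite orbF; case: eqP => [->|]; rewrite ?cats0.
by rewrite orbT eq_sym (negbTE uw) s_w cats0.
Qed.

End StackFragments.

(** * Renaming tapes *)

Section Lift.

Variables (V V' : finType) (e : V -> V').
Hypothesis e_inj : injective e.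

Definition graft (T : Type) (f : V -> T) (g : V' -> T) : V' -> T :=
  fun v' => if [pick v | e v == v'] is Some v then f v else g v'.

Lemma graft_in T (f : V -> T) (g : V' -> T) v : graft f g (e v) = f v.
Proof.
by rewrite /graft; case: pickP => [w /eqP /e_inj -> //|/(_ v)]; rewrite eqxx.
Qed.

Lemma graft_out T (f : V -> T) (g : V' -> T) v' :
  (forall v, e v != v') -> graft f g v' = g v'.
Proof.
by rewrite /graft => eN; case: pickP => // v; rewrite (negbTE (eN v)).
Qed.

Definition flift (F : frag V) : frag V' :=
  @Frag V' (fstate F) (fstart F) (fun q r =>
    ((ftrans q (r \o e)).1, graft (ftrans q (r \o e)).2 (idle r))).

Lemma acts_graft (a : V -> option bool * move) (t : V' -> stape) :
  acts (graft a (idle (reads t))) t = graft (acts a (t \o e)) t.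
Proof.
apply: functional_extensionality => v'; rewrite /acts /graft.
by case: pickP => [v /eqP <- //|_]; apply: stape_act_read.
Qed.

Lemma run_lift (F : frag V) q (t : V' -> stape) n u :
  @run V F q (t \o e) n u -> @run V' (flift F) q t n (graft u t).
Proof.
move te: (t \o e) => t0 run_u.
elim: run_u t te => [{}q {}t0 a tr_q|{}q {}t0 a q' {}n {}u tr_q _ IH] t te.
  rewrite -te -acts_graft; rewrite -te in tr_q.
  by apply: run_exit; rewrite /= tr_q.
set t' := acts (graft a (idle (reads t))) t.
have t'e : t' \o e = acts a t0.
  apply: functional_extensionality => v.
  by rewrite /t' /= acts_graft graft_in te.
have -> : graft u t = graft u t'.
  apply: functional_extensionality => v'; rewrite /t' acts_graft /graft.
  by case: pickP.
by apply: run_step (IH _ t'e); rewrite -te in tr_q; rewrite /= tr_q.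
Qed.

Lemma exec_lift (F : frag V) (t : V' -> stape) n u :
  exec F (t \o e) n u -> exec (flift F) t n (graft u t).
Proof. by case=> m le_m run_u; exists m => //; apply: run_lift. Qed.

End Lift.

(** * Polynomial bounds *)

Lemma horner_nat_leq (p : {poly nat}) m n : m <= n -> p.[m]%R <= p.[n]%R.
Proof.
move=> le_mn; elim/poly_ind: p => [|p c IH]; first by rewrite !horner0.
by rewrite !hornerMXaddC leq_add2r leq_mul.
Qed.

Definition poly_bounded (f : nat -> nat) : Prop :=
  exists p : {poly nat}, forall n, f n <= p.[n]%R.

Lemma poly_bounded_const c : poly_bounded (fun=> c).
Proof. by exists (c%:P)%R => n; rewrite hornerC. Qed.

Lemma poly_bounded_id : poly_bounded id.
Proof. by exists 'X%R => n; rewrite hornerX. Qed.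

Lemma poly_bounded_add f g : poly_bounded f -> poly_bounded g ->
  poly_bounded (fun n => f n + g n).
Proof.
case=> p fp [q gq]; exists (p + q)%R => n; rewrite hornerD.
exact: leq_add (fp n) (gq n).
Qed.

Lemma poly_bounded_mul f g : poly_bounded f -> poly_bounded g ->
  poly_bounded (fun n => f n * g n).
Proof.
case=> p fp [q gq]; exists (p * q)%R => n; rewrite hornerM.
exact: leq_mul (fp n) (gq n).
Qed.

Lemma poly_bounded_horner (p : {poly nat}) f : poly_bounded f ->
  poly_bounded (fun n => p.[f n]%R).
Proof.
case=> q fq; exists (p \Po q)%R => n.
by rewrite horner_comp; apply: horner_nat_leq.
Qed.

Ltac poly_bound :=
  repeat first [ assumption | exact: poly_bounded_const | exact: poly_bounded_id
    | apply: poly_bounded_horner | apply: poly_bounded_add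
    | apply: poly_bounded_mul ].

(** * Machines and fragments *)

Definition config_stapes (M : machine) (c : config M) :
  'I_(ntapes M).+1 -> stape := fun i => tape_stream (c.2 i).

Lemma config_stapes_init (M : machine) (xs : seq bits) :
  config_stapes (init M xs) =
  stacks (fun i : 'I_(ntapes M).+1 => nth [::] xs i).
Proof.
apply: functional_extensionality => i.
by rewrite /config_stapes ffunE tape_stream_stack.
Qed.

Lemma reads_config_stapes (M : machine) (c : config M) :
  reads (config_stapes c) = [ffun i => tape_read (c.2 i)].
Proof.
apply: functional_extensionality => i.
by rewrite ffunE /reads stape_read_tape_stream.
Qed.

Lemma config_stapes_act (M : machine) (c : config M) q a :
  config_stapes ((q, [ffun i => tape_act (a i) (c.2 i)]) : config M) =
  acts a (config_stapes c).
Proof.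
apply: functional_extensionality => i.
by rewrite /config_stapes ffunE tape_stream_act.
Qed.

Definition frag_machine (n : nat) (F : frag 'I_n.+1) : machine :=
  @Machine n (option (fstate F)) (Some (fstart F)) (pred1 None)
    (fun q r => if q is Some q then
       ((ftrans q r).1, [ffun i => (ftrans q r).2 i])
     else (None, [ffun=> (None, Stay)])).

Lemma run_frag_machine n (F : frag 'I_n.+1) q t m u :
  @run _ F q t m u ->
  forall c : config (frag_machine F), c.1 = Some q -> config_stapes c = t ->
  (iter m (@step _) c).1 = None /\ config_stapes (iter m (@step _) c) = u.
Proof.
have step_frag (c : config (frag_machine F)) q0 o a : c.1 = Some q0 ->
    ftrans q0 (reads (config_stapes c)) = (o, a) ->
    (step c).1 = o /\ config_stapes (step c) = acts a (config_stapes c).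
  rewrite reads_config_stapes => cq tr_q0.
  rewrite /step /= cq /= tr_q0 config_stapes_act /=; split=> //.
  by congr acts; apply: functional_extensionality => i; rewrite ffunE.
elim=> [{}q {}t a tr_q|{}q {}t a q' k {}u tr_q _ IH] c cq ct.
  by rewrite -ct; apply: step_frag cq _; rewrite ct.
have [|step_q' step_t] := step_frag c q (Some q') a cq; first by rewrite ct.
by rewrite iterSr; apply: IH; rewrite ?step_t ?ct.
Qed.

Definition machine_frag (M : machine) : frag 'I_(ntapes M).+1 :=
  @Frag _ (state M) (start M) (fun q r =>
    if halting q then (None, idle r) else
    (Some (trans q (finfun r)).1, fun i => (trans q (finfun r)).2 i)).

Lemma run_machine_frag (M : machine) (c : config M) n :
  halting (iter n (@step M) c).1 ->
  exists2 m, m <= n.+1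
    & @run _ (machine_frag M) c.1 (config_stapes c) m
           (config_stapes (iter n (@step M) c)).
Proof.
elim: n c => [|n IH] c.
  move=> c_halts; exists 1 => //; rewrite -{2}[config_stapes _]acts_idle.
  by apply: run_exit; rewrite /= c_halts.
rewrite iterSr; case c_halts: (halting c.1).
  have -> : step c = c by rewrite /step c_halts.
  by case/IH => m le_m run_m; exists m => //; apply: leqW.
case/IH => m le_m run_m; exists m.+1 => //; move: run_m.
rewrite {1 2}/step c_halts; set tr := trans _ _; case trE: tr => [q a] run_m.
rewrite config_stapes_act in run_m; apply: run_step run_m.
rewrite /= c_halts reads_config_stapes.
have -> : finfun [ffun i => tape_read (c.2 i)] = [ffun i => tape_read (c.2 i)].
  by apply/ffunP => i; rewrite !ffunE.
by rewrite -/tr trE.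
Qed.

Lemma ord_injection_index (V : finType) (u0 : V) (us : seq V) :
  exists (n : nat) (e : V -> 'I_n.+1), injective e /\
    forall v, e v = index v (u0 :: us) :> nat \/
              v \notin u0 :: us /\ size us < e v.
Proof.
pose vs := [seq v <- enum V | v \notin u0 :: us].
have all_vs v : v \in (u0 :: us) ++ vs.
  by rewrite mem_cat mem_filter mem_enum andbT orbN.
pose e v : 'I_(size (us ++ vs)).+1 := inord (index v ((u0 :: us) ++ vs)).
have e_val v : e v = index v ((u0 :: us) ++ vs) :> nat.
  by rewrite inordK // -[(size _).+1]/(size ((u0 :: us) ++ vs)) index_mem.
exists (size (us ++ vs)), e; split=> [v w ev_ew|v].
  by rewrite -(nth_index u0 (all_vs v)) -e_val ev_ew e_val nth_index.
rewrite e_val index_cat; case: ifPn => [_|vN]; [by left | right].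
by rewrite /= leq_addr.
Qed.

Lemma frag_polytime (X : Type) (inp : X -> seq bits) (out : X -> bits)
    (V : finType) (F : frag V) (s : X -> V -> bits) (u0 : V) (us : seq V)
    (f : nat -> nat) :
  (forall x, inp x = [seq s x v | v <- u0 :: us]) ->
  (forall x v, v \notin u0 :: us -> s x v = [::]) ->
  poly_bounded f ->
  (forall x, exists2 t, exec F (stacks (s x)) (f (sumn (map size (inp x)))) t
                      & shows (t u0) (out x)) ->
  polytime inp out.
Proof.
move=> inpE s_blank [p f_le_p] exF.
have [n [e [e_inj e_index]]] := ord_injection_index u0 us.
exists (frag_machine (flift e F)), p => x; have [t exF_t t_out] := exF x.
pose c := init (frag_machine (flift e F)) (inp x).
have init_e : config_stapes c \o e = stacks (s x).
  rewrite config_stapes_init; apply: functional_extensionality => v /=.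
  rewrite /stacks inpE; congr stack; case: (e_index v) => [->|[vN lt_us]].
    case: (boolP (v \in u0 :: us)) => [v_us|vN].
      by rewrite (nth_map u0) ?index_mem ?nth_index.
    by rewrite s_blank // nth_default // size_map memNindex.
  by rewrite s_blank // nth_default // size_map.
rewrite -init_e in exF_t; have [m le_m run_t] := exec_lift e_inj exF_t.
have [halt_m end_m] := run_frag_machine run_t (erefl c.1) erefl.
exists m; split; first exact: leq_trans (f_le_p _).
- by rewrite halt_m.
- apply: shows_bits_before_blank; rewrite -/(config_stapes _ ord0) end_m.
  suff <- : e u0 = ord0 by rewrite graft_in.
  by apply: ord_inj; case: (e_index u0) => [->|[]]; rewrite /= ?eqxx ?mem_head.
Qed.

(** * Size bounds *)

Lemma computes_within_size (M : machine) xs y n :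
  computes_within M xs y n -> size y <= sumn (map size xs) + n.*2.
Proof.
case=> m [le_m _ <-]; rewrite /output.
have size_bits_before_blank s : size (bits_before_blank s) <= size s.
  by elim: s => [|[b|] s IH].
apply: leq_trans (size_bits_before_blank _) _.
have size_step (c : config M) :
    size ((step c).2 ord0).2 <= size (c.2 ord0).2 + 2.
  rewrite /step; case: ifP => _; first exact: leq_addr.
  case: (trans _ _) => q a /=; rewrite ffunE; case: (a ord0) => b [];
    rewrite /tape_act /= size_behead; lia.
have size_iter : size (((iter m (@step M) (init M xs)).2 ord0).2)
    <= size (((init M xs).2 ord0).2) + m.*2.
  elim: m {le_m} => [|m IH]; first by rewrite addn0.
  by rewrite iterS; apply: leq_trans (size_step _) _; lia.
apply: leq_trans size_iter _; apply: leq_add; last by rewrite leq_double.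
by rewrite /= ffunE size_map; case: xs => [|x xs] //=; apply: leq_addr.
Qed.

Lemma polytime_size (X : Type) (inp : X -> seq bits) out :
  polytime inp out ->
  exists p : {poly nat}, forall x,
    size (out x) <= p.[sumn (map size (inp x))]%R.
Proof.
case=> M [p Mp]; have [||q pq] :=
    @poly_bounded_add id (fun n => p.[n]%R + p.[n]%R); try by poly_bound.
exists q => x; apply: leq_trans (pq _); rewrite addnn.
exact: computes_within_size.
Qed.

Lemma sumn_size_leq (T : Type) (F : T -> bits) (r : seq T) n :
  (forall i, size (F i) <= n) -> sumn (map size (map F r)) <= size r * n.
Proof. by move=> Fn; elim: r => //= i r IH; rewrite mulSn leq_add. Qed.

(** * Register programs *)

Definition with_workspace (R W : finType) (s : R -> bits) : R + W -> bits :=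
  fun v => if v is inl r then s r else [::].

(* [N x] is the size parameter in which the time is polynomial.  The workspace
   [W] is private to the program: it is blank at the start, and its final
   contents are irrelevant. *)
Definition reg_polytime (X : Type) (R : finType) (N : X -> nat)
    (s s' : X -> R -> bits) : Prop :=
  exists (W : finType) (F : frag (R + W)%type) (f : nat -> nat),
  poly_bounded f /\
  forall x, exists2 t, exec F (stacks (with_workspace (s x))) (f (N x)) t
                     & forall r, t (inl r) = stack (s' x r).

Section RegisterPrograms.

Variables (X : Type) (R : finType).
Implicit Types (N : X -> nat) (s : X -> R -> bits).

Definition widenl (W W' : Type) (v : R + W) : R + (W + W') :=
  match v with inl r => inl r | inr w => inr (inl w) end.

Definition widenr (W W' : Type) (v : R + W') : R + (W + W') :=
  match v with inl r => inl r | inr w => inr (inr w) end.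

Lemma exec_widenl (W W' : finType) (F : frag (R + W)%type) (s0 : R -> bits)
    n t :
  exec F (stacks (with_workspace s0)) n t ->
  exists2 t', exec (flift (@widenl W W') F) (stacks (with_workspace s0)) n t'
    & (forall r, t' (inl r) = t (inl r)) /\
      (forall w', t' (inr (inr w')) = stack [::]).
Proof.
have inj : injective (@widenl W W') by case=> [r|w] [r'|w'] // [->].
move=> exF; exists (graft (@widenl W W') t (stacks (with_workspace s0))).
  apply: exec_lift => //; move: exF; congr exec.
  by apply: functional_extensionality => -[].
split=> [r|w']; first exact: (graft_in inj _ _ (inl r)).
by rewrite graft_out //; case.
Qed.

Lemma exec_widenr (W W' : finType) (F : frag (R + W')%type) (s0 : R -> bits)
    (t0 : R + (W + W') -> stape) n t :
  (forall r, t0 (inl r) = stack (s0 r)) ->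
  (forall w', t0 (inr (inr w')) = stack [::]) ->
  exec F (stacks (with_workspace s0)) n t ->
  exists2 t', exec (flift (@widenr W W') F) t0 n t'
    & forall r, t' (inl r) = t (inl r).
Proof.
move=> t0_s0 t0_blank; have inj : injective (@widenr W W').
  by case=> [r|w] [r'|w'] // [->].
move=> exF; exists (graft (@widenr W W') t t0) => [|r].
  apply: exec_lift => //; move: exF; congr exec.
  by apply: functional_extensionality => -[r|w'] /=; rewrite ?t0_s0 ?t0_blank.
exact: (graft_in inj _ _ (inl r)).
Qed.

Lemma reg_polytime_seq N s1 s2 s3 :
  reg_polytime N s1 s2 -> reg_polytime N s2 s3 -> reg_polytime N s1 s3.
Proof.
case=> W1 [F1 [f1 [f1_poly exF1]]] [W2 [F2 [f2 [f2_poly exF2]]]].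
exists (W1 + W2)%type,
  (fseq (flift (@widenl W1 W2) F1) (flift (@widenr W1 W2) F2)).
exists (fun n => f1 n + f2 n); split=> [|x]; first by poly_bound.
have [t1 ex1 t1_s2] := exF1 x; have [t2 ex2 t2_s3] := exF2 x.
have [u1 ex_u1 [u1_t1 u1_blank]] := exec_widenl W2 ex1.
have [|//|u2 ex_u2 u2_t2] := exec_widenr (t0 := u1) _ _ ex2.
  by move=> r; rewrite u1_t1.
exists u2 => [|r]; last by rewrite u2_t2.
exact: exec_seq ex_u1 ex_u2.
Qed.

Lemma reg_polytime_if N s s' (b : X -> bool) (r0 : R) :
  (forall x, b x = (ohead (s x r0) == Some true)) ->
  reg_polytime (fun x : {x | b x} => N (sval x))
    (fun x => s (sval x)) (fun x => s' (sval x)) ->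
  reg_polytime (fun x : {x | ~~ b x} => N (sval x))
    (fun x => s (sval x)) (fun x => s' (sval x)) ->
  reg_polytime N s s'.
Proof.
move=> bE [W1 [F1 [f1 [f1_poly exF1]]]] [W2 [F2 [f2 [f2_poly exF2]]]].
exists (W1 + W2)%type, (fif (fun h => h (inl r0) == Some true)
  (flift (@widenl W1 W2) F1) (flift (@widenr W1 W2) F2)).
exists (fun n => (f1 n + f2 n) + 1); split=> [|x]; first by poly_bound.
rewrite addn1; set t := stacks _.
have testE : (reads t (inl r0) == Some true) = b x.
  by rewrite bE /reads stape_read_stack.
case bx: (b x).
- have [t1 ex1 t1_s'] := exF1 (exist _ x bx).
  have [u ex_u [u_t1 _]] := exec_widenl W2 ex1.
  exists u => [|r]; last by rewrite u_t1 t1_s'.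
  apply: exec_if; rewrite testE bx; apply: exec_leq ex_u; exact: leq_addr.
- have [t2 ex2 t2_s'] := exF2 (exist _ x (negbT bx)).
  have [//|//|u ex_u u_t2] := exec_widenr (W := W1) (t0 := t) _ _ ex2.
  exists u => [|r]; last by rewrite u_t2 t2_s'.
  apply: exec_if; rewrite testE bx; apply: exec_leq ex_u; exact: leq_addl.
Qed.

End RegisterPrograms.

Definition fextract (V : finType) (u tmp w : V) : frag V :=
  fseq (fclear w) (fseq (fmove u (pred1 tmp)) (fmove tmp (pred1 w))).

Lemma exec_extract (V : finType) (u tmp w : V) (t : V -> stape) y z :
  uniq [:: u; tmp; w] ->
  shows (t u) y -> t tmp = stack [::] -> t w = stack z ->
  exists2 t', exec (fextract u tmp w) t (4 * size z + 1 + (8 * size y + 2)) t'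
            & forall v, v != u -> t' v = if v == w then stack y else t v.
Proof.
rewrite /= !inE negb_or => /and3P [/andP [u_tmp u_w] tmp_w _] t_u t_tmp t_w.
have wz : shows (t w) z by rewrite t_w; apply: shows_stack.
have := exec_move pred0 wz; set t1 := fun v => _ => ex_clear.
have t1_u : shows (t1 u) y by rewrite /t1 (negbTE u_w).
have := exec_move (pred1 tmp) t1_u; set t2 := fun v => _ => ex_to_tmp.
have t2_tmp : t2 tmp = stack (rev y).
  rewrite /t2 /t1 eq_sym (negbTE u_tmp) (negbTE tmp_w) /= eqxx t_tmp.
  exact: push_all_stack.
have tmp_rev : shows (t2 tmp) (rev y) by rewrite t2_tmp; apply: shows_stack.
have := exec_move (pred1 w) tmp_rev; set t3 := fun v => _ => ex_to_w.
exists t3 => [|v v_u].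
  have -> : 8 * size y + 2 = 4 * size y + 1 + (4 * size (rev y) + 1).
    by rewrite size_rev; lia.
  exact: exec_seq ex_clear (exec_seq ex_to_tmp ex_to_w).
rewrite /t3; case: (eqVneq v tmp) => [->|v_tmp].
  by rewrite t2_tmp iter_pop_stack (negbTE tmp_w) t_tmp.
rewrite /t2 (negbTE v_u) /= (negbTE v_tmp) /t1; case: eqP => //= ->.
by rewrite t_w iter_pop_stack push_all_stack catrevE revK cats0.
Qed.

Section Assignment.

Variable R : finType.
Implicit Types (s : R -> bits) (src : seq R).

(* Next to the registers there is a copy [Some j] of each tape of the machine to
   be called, and a scratch tape [None]. *)
Definition loaded n s (z : 'I_n -> bits) : R + option 'I_n -> bits :=
  fun v => match v with
           | inl r => s r
           | inr (Some j) => z j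
           | inr None => [::]
           end.

Definition fload n src (js : seq 'I_n) : frag (R + option 'I_n)%type :=
  foldr (fun j : 'I_n =>
           fseq (if onth src j is Some r
                 then fcopy (inr None) (inl r) (inr (Some j)) else fskip _))
        (fskip _) js.

Lemma sexec_load n src (js : seq 'I_n) s z B :
  uniq js -> (forall j, j \in js -> z j = [::]) ->
  (forall r, size (s r) <= B) ->
  sexec (fload src js) (loaded s z) (size js * (8 * B + 2) + 2)
    (loaded s (fun j => if j \in js then nth [::] (map s src) j else z j)).
Proof.
move=> + + sB; elim: js z => [|j js IH] z /=.
  by move=> *; apply: exec_skip.
case/andP=> jN js_uniq zN; rewrite mulSn -addnA.
pose z1 j' := if j' == j then nth [::] (map s src) j else z j'.
apply: (@exec_seq _ _ _ _ (stacks (loaded s z1))).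
- have zj : z j = [::] by rewrite zN ?mem_head.
  rewrite /z1 -odflt_onth onth_map; case src_j: (onth src j) => [r|] /=.
    apply: (@exec_leq _ _ _ _ (8 * size (s r) + 2)).
      by rewrite leq_add2r leq_mul2l sB.
    have := @sexec_copy _ (inr None) (inl r) (inr (Some j)) (loaded s z).
    move=> /(_ isT erefl zj); rewrite /sexec; congr exec.
    by apply: functional_extensionality => -[|[]].
  rewrite (_ : loaded s _ = loaded s z).
    by apply: exec_leq (exec_skip _); rewrite leq_addl.
  by apply: functional_extensionality => -[|[]] //= j'; case: eqP => // ->.
rewrite (_ : (fun j' => _) =
    fun j' => if j' \in js then nth [::] (map s src) j' else z1 j').
  apply: IH => // j' j'_js; rewrite /z1.
  case: eqP j'_js jN => [->->|_ j'_js _] //.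
  by rewrite zN // inE j'_js orbT.
apply: functional_extensionality => j'; rewrite inE /z1.
by case: eqP => [->|] //=; rewrite (negbTE jN).
Qed.

Definition fassign (M : machine) src (dst : R) :
    frag (R + option 'I_(ntapes M).+1)%type :=
  fseq (fload src (enum 'I_(ntapes M).+1))
 (fseq (flift (fun i => inr (Some i)) (machine_frag M))
       (fextract (inr (Some ord0)) (inr None) (inl dst))).

Lemma exec_assign M src dst s y n B :
  (forall r, size (s r) <= B) -> computes_within M (map s src) y n ->
  exists2 t, exec (fassign M src dst) (stacks (with_workspace s))
      (((ntapes M).+1 * (8 * B + 2) + 2) +
       ((n + 1) + (4 * B + 1 + (8 * size y + 2)))) t
    & forall r, t (inl r) = stack (upd s dst y r).
Proof.
move=> sB [m [le_m halt_m out_m]].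
pose tape_of (i : 'I_(ntapes M).+1) : R + _ := inr (Some i).
have tape_of_inj : injective tape_of by move=> i j [].
pose s_load := loaded s (fun j : 'I_(ntapes M).+1 => nth [::] (map s src) j).
have ex_load : sexec (fload src (enum 'I_(ntapes M).+1)) (with_workspace s)
    ((ntapes M).+1 * (8 * B + 2) + 2) s_load.
  have := sexec_load src (enum_uniq 'I_(ntapes M).+1) (fun _ _ => erefl) sB.
  rewrite size_enum_ord /sexec; congr exec; apply: functional_extensionality.
    by case=> [|[]].
  by case=> [|[j|]] //; rewrite /stacks /= mem_enum.
have [k le_k run_k] := run_machine_frag halt_m.
pose t_call := graft tape_of
  (config_stapes (iter m (@step M) (init M (map s src)))) (stacks s_load).
have ex_call :
    exec (flift tape_of (machine_frag M)) (stacks s_load) (n + 1) t_call.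
  apply: exec_lift => //; exists k.
    by rewrite addn1; apply: leq_trans le_k _.
  by rewrite config_stapes_init in run_k.
have t_call_out : shows (t_call (tape_of ord0)) y.
  by rewrite /t_call graft_in // -out_m; apply: shows_tape_stream.
have t_call_off v : (forall i, tape_of i != v) -> t_call v = stack (s_load v).
  by move=> vN; rewrite /t_call graft_out.
have [|||t ex_extract t_off] :=
    @exec_extract _ (inr (Some ord0)) (inr None) (inl dst)
      t_call y (s dst) _ t_call_out; rewrite ?t_call_off //.
exists t => [|r]; last first.
  by rewrite t_off // t_call_off // /upd -[inl r == _]/(r == dst); case: eqP.
apply: exec_seq ex_load (exec_seq ex_call (exec_leq _ ex_extract)).
by rewrite !leq_add2r leq_mul2l sB.
Qed.

Lemma reg_polytime_assign (X : Type) (N : X -> nat) (s : X -> R -> bits)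
    (src : seq R) (dst : R) (out : X -> bits) (B : nat -> nat) :
  polytime (fun x => [seq s x r | r <- src]) out ->
  poly_bounded B -> (forall x r, size (s x r) <= B (N x)) ->
  reg_polytime N s (fun x => upd (s x) dst (out x)).
Proof.
move=> pout B_poly sB; have [q out_q] := polytime_size pout.
case: pout => M [p Mp].
exists (option 'I_(ntapes M).+1), (fassign M src dst).
exists (fun n => ((ntapes M).+1 * (8 * B n + 2) + 2) +
  ((p.[size src * B n]%R + 1) +
   (4 * B n + 1 + (8 * q.[size src * B n]%R + 2)))).
split=> [|x]; first by poly_bound.
have size_src : sumn (map size [seq s x r | r <- src]) <= size src * B (N x).
  exact: sumn_size_leq (sB x).
have [t ex_t t_upd] := exec_assign dst (sB x) (Mp x).
exists t => //; apply: exec_leq ex_t.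
have out_le := leq_trans (out_q x) (horner_nat_leq q size_src).
rewrite leq_add2l; apply: leq_add; first by rewrite leq_add2r horner_nat_leq.
by rewrite leq_add2l leq_add2r leq_mul2l out_le orbT.
Qed.

End Assignment.

(** * Closure properties of polynomial time *)

Lemma polytime_restrict (X Y : Type) (inp : X -> seq bits) (out : X -> bits)
    (inp' : Y -> seq bits) (out' : Y -> bits) :
  (forall y, exists2 x, inp x = inp' y & out x = out' y) ->
  polytime inp out -> polytime inp' out'.
Proof. by move=> xP [M [p Mp]]; exists M, p => y; have [x <- <-] := xP y. Qed.

Definition select (e : seq nat) (xs : seq bits) : seq bits :=
  [seq nth [::] xs i | i <- e].

(* The register [None] is spare. *)
Definition input_registers (k : nat) (xs : seq bits) (r : option 'I_k) : bits :=
  oapp (fun i : 'I_k => nth [::] xs i) [::] r.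

Lemma size_input_registers k xs (r : option 'I_k) :
  size (input_registers xs r) <= sumn (map size xs).
Proof.
case: r => [[i /= _]|] //; elim: xs i => [|y xs IH] [|i] //=.
  exact: leq_addr.
by apply: leq_trans (IH i) _; apply: leq_addl.
Qed.

Lemma map_input_registers k xs : size xs = k ->
  [seq input_registers xs r | r <- map Some (enum 'I_k)] = xs.
Proof.
move=> <-; rewrite -map_comp; apply: (@eq_from_nth _ [::]).
  by rewrite size_map size_enum_ord.
move=> i; rewrite size_map size_enum_ord => lt_i.
by rewrite (nth_map (Ordinal lt_i)) ?size_enum_ord //= nth_enum_ord.
Qed.

Lemma select_input_registers k xs e : size xs = k ->
  [seq input_registers xs (insub i : option 'I_k) | i <- e] = select e xs.
Proof.
move=> xs_k; apply: eq_map => i; case: insubP => [j _ <- //|].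
by rewrite -leqNgt -xs_k => le_i; rewrite nth_default.
Qed.

Section Closure.

Variables (X : Type) (inp : X -> seq bits) (k : nat).
Hypothesis size_inp : forall x, size (inp x) = k.+1.

Let inp_size x := sumn (map size (inp x)).
Let inp_regs x : option 'I_k.+1 -> bits := input_registers (inp x).
Let all_inputs : seq (option 'I_k.+1) := map Some (enum 'I_k.+1).

Lemma polytime_of_registers s :
  reg_polytime inp_size inp_regs s -> polytime inp (fun x => s x (Some ord0)).
Proof.
case=> W [F [f [f_poly exF]]].
have inputsE : all_inputs = Some ord0 :: map Some (map (lift ord0) (enum 'I_k)).
  by rewrite /all_inputs enum_ordSl.
apply: (@frag_polytime _ _ _ _ F (fun x => with_workspace (inp_regs x))
  (inl (Some ord0)) [seq inl (Some (lift ord0 i)) | i <- enum 'I_k] f) => //.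
- move=> x; rewrite -{1}(map_input_registers (size_inp x)) -/all_inputs inputsE.
  by rewrite /= -!map_comp.
- move=> x [[r|]|w] //; apply: contraNeq => _; rewrite inE.
  case: (unliftP ord0 r) => [i ->|-> //].
  by apply/orP; right; apply: map_f; rewrite mem_enum.
move=> x; have [t ex_t tE] := exF x; exists t => //.
by rewrite tE; apply: shows_stack.
Qed.

Lemma polytime_select e out :
  polytime (fun x => select e (inp x)) out -> polytime inp out.
Proof.
move=> pout.
pose src : seq (option 'I_k.+1) := [seq insub i | i <- e].
apply: (@polytime_of_registers (fun x => upd (inp_regs x) (Some ord0) (out x))).
apply: (@reg_polytime_assign _ _ _ _ src _ _ id _ poly_bounded_id).
  apply: polytime_restrict pout => x; exists x => //.
  by rewrite -(select_input_registers e (size_inp x)) -map_comp.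
by move=> x r; apply: size_input_registers.
Qed.

Lemma reg_polytime_spare g : polytime inp g ->
  reg_polytime inp_size inp_regs (fun x => upd (inp_regs x) None (g x)).
Proof.
move=> pg.
apply: (@reg_polytime_assign _ _ _ _ all_inputs _ _ id _ poly_bounded_id).
  apply: polytime_restrict pg => x; exists x => //.
  by rewrite map_input_registers.
by move=> x r; apply: size_input_registers.
Qed.

Lemma size_spare_leq g : polytime inp g ->
  exists2 B, poly_bounded B
    & forall x r, size (upd (inp_regs x) None (g x) r) <= B (inp_size x).
Proof.
case/polytime_size => q gq; exists (fun n => n + q.[n]%R); first by poly_bound.
move=> x r; rewrite /upd; case: eqP => _.
  exact: leq_trans (gq x) (leq_addl _ _).
exact: leq_trans (size_input_registers _ _) (leq_addr _ _).
Qed.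

Lemma map_all_inputs_spare x y :
  [seq upd (inp_regs x) None y r | r <- all_inputs] = inp x.
Proof. by rewrite -[RHS](map_input_registers (size_inp x)) -!map_comp. Qed.

Lemma polytime_let g out :
  polytime inp g -> polytime (fun x => g x :: inp x) out -> polytime inp out.
Proof.
move=> pg pout; have [B B_poly size_B] := size_spare_leq pg.
pose s x := upd (upd (inp_regs x) None (g x)) (Some ord0) (out x).
apply: (@polytime_of_registers s).
apply: reg_polytime_seq (reg_polytime_spare pg) _.
apply: (@reg_polytime_assign _ _ _ _ (None :: all_inputs) _ _ B) => //.
apply: polytime_restrict pout => x; exists x => //.
by rewrite map_cons map_all_inputs_spare.
Qed.

Lemma polytime_if g (b : X -> bool) out :
  (forall x, b x = (ohead (g x) == Some true)) ->
  polytime inp g ->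
  polytime (fun x : {x | b x} => inp (sval x)) (fun x => out (sval x)) ->
  polytime (fun x : {x | ~~ b x} => inp (sval x)) (fun x => out (sval x)) ->
  polytime inp out.
Proof.
move=> bE pg pout_true pout_false; have [B B_poly size_B] := size_spare_leq pg.
pose s x := upd (upd (inp_regs x) None (g x)) (Some ord0) (out x).
apply: (@polytime_of_registers s).
apply: reg_polytime_seq (reg_polytime_spare pg) _.
apply: (@reg_polytime_if _ _ _ _ _ b None) => //.
- apply: (@reg_polytime_assign _ _ _ _ all_inputs _ _ B) => //.
  apply: polytime_restrict pout_true => x; exists x => //.
  by rewrite map_all_inputs_spare.
- apply: (@reg_polytime_assign _ _ _ _ all_inputs _ _ B) => //.
  apply: polytime_restrict pout_false => x; exists x => //.
  by rewrite map_all_inputs_spare.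
Qed.

Lemma polytime_const y out : (forall x, out x = y) -> polytime inp out.
Proof.
move=> outE; pose s x (v : 'I_k.+1) := nth [::] (inp x) v.
apply: (@frag_polytime _ _ _ _ (fwrite ord0 y) s ord0
  (map (lift ord0) (enum 'I_k)) (fun n => 4 * n + 1 + 2 * size y)).
- move=> x; rewrite -enum_ordSl -{1}(map_input_registers (size_inp x)).
  by rewrite -map_comp.
- by move=> x v; rewrite -enum_ordSl mem_enum.
- by poly_bound.
move=> x; rewrite outE; exists (stacks (upd (s x) ord0 y)).
apply: exec_leq (sexec_write _ _ _); rewrite !leq_add2r leq_mul2l.
  exact: (size_input_registers (inp x) (Some (ord0 : 'I_k.+1))).
exact: shows_stack.
Qed.

End Closure.

Section BooleanClosure.

Variables (X : Type) (inp : X -> seq bits) (k : nat).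
Hypothesis size_inp : forall x, size (inp x) = k.+1.

Lemma polytime_andb a b :
  polytime inp (fun x => enc_bool (a x)) ->
  polytime inp (fun x => enc_bool (b x)) ->
  polytime inp (fun x => enc_bool (a x && b x)).
Proof.
move=> pa pb; apply: (polytime_if (b := a) size_inp _ pa) => [x||].
- by case: (a x).
- by apply: polytime_restrict pb => -[x ax]; exists x => //=; rewrite ax.
- apply: (@polytime_const _ _ k _ (enc_bool false)) => [[x ?]|[x aNx] /=] //.
  by rewrite (negbTE aNx).
Qed.

Lemma polytime_negb a :
  polytime inp (fun x => enc_bool (a x)) ->
  polytime inp (fun x => enc_bool (~~ a x)).
Proof.
move=> pa; apply: (polytime_if (b := a) size_inp _ pa) => [x||].
- by case: (a x).
- apply: (@polytime_const _ _ k _ (enc_bool false)) => [[x ?]|[x ax] /=] //.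
  by rewrite ax.
- apply: (@polytime_const _ _ k _ (enc_bool true)) => [[x ?]|[x aNx] /=] //.
  by rewrite aNx.
Qed.

End BooleanClosure.

Lemma polytime_id : polytime (fun y => [:: y]) id.
Proof.
apply: (@frag_polytime _ _ _ _ (fskip unit) (fun y _ => y)
  tt [::] (fun=> 2)) => //.
  by poly_bound.
move=> y; exists (stacks (fun=> y)); last exact: shows_stack.
exact: exec_skip.
Qed.

Lemma polytime_behead : polytime (fun y => [:: y]) behead.
Proof.
apply: (@frag_polytime _ _ _ _ (fops (fun _ : unit => Pop)) (fun y _ => y)
  tt [::] (fun=> 2)) => //.
  by poly_bound.
move=> y; exists (stacks (fun=> behead y)); last exact: shows_stack.
exact: (@sexec_ops unit (fun=> Pop) (fun=> y)).
Qed.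

Lemma polytime_nth (X : Type) (inp : X -> seq bits) k i :
  (forall x, size (inp x) = k.+1) -> polytime inp (fun x => nth [::] (inp x) i).
Proof.
move=> size_inp; apply: (polytime_select size_inp (e := [:: i])).
by apply: polytime_restrict polytime_id => x; exists (nth [::] (inp x) i).
Qed.

Lemma polytime_comp (X : Type) (inp : X -> seq bits) k (gs : seq (X -> bits))
    out :
  (forall x, size (inp x) = k.+1) ->
  (forall g, List.In g gs -> polytime inp g) ->
  polytime (fun x => [seq g x | g <- gs]) out -> polytime inp out.
Proof.
move=> size_inp pgs pout.
have size_gs_inp (hs : seq (X -> bits)) x :
    size ([seq h x | h <- hs] ++ inp x) = (size hs + k).+1.
  by rewrite size_cat size_map size_inp addnS.
suff: polytime (fun x => [seq g x | g <- gs] ++ inp x) out.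
  elim: gs pgs {pout} => [|g gs IH] //= pgs pout.
  apply: IH => [g' g'_gs|]; first by apply: pgs; right.
  apply: (polytime_let (size_gs_inp gs)) pout.
  apply: (polytime_select (size_gs_inp gs) (e := iota (size gs) k.+1)).
  have pg : polytime inp g by apply: pgs; left.
  apply: polytime_restrict pg => x; exists x => //.
  rewrite /select map_nth_iota.
    by rewrite drop_size_cat ?size_map // take_oversize ?size_inp.
  by rewrite size_gs_inp; lia.
apply: (polytime_select (size_gs_inp gs) (e := iota 0 (size gs))).
apply: polytime_restrict pout => x; exists x => //.
rewrite /select map_nth_iota0.
  by rewrite take_size_cat ?size_map.
by rewrite size_gs_inp leqW ?leq_addr.
Qed.

Lemma polytime_comp1 (X Y : Type) (inp : X -> seq bits) k (h : X -> Y)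
    (e : Y -> bits) out :
  (forall x, size (inp x) = k.+1) -> polytime (fun y => [:: e y]) out ->
  polytime inp (fun x => e (h x)) -> polytime inp (fun x => out (h x)).
Proof.
move=> size_inp pout pe; pose gs := [:: fun x => e (h x)].
apply: (polytime_comp (gs := gs) size_inp) => [g [<-|//] //|].
by apply: polytime_restrict pout => x; exists (h x).
Qed.

Lemma polytime_comp2 (X Y : Type) (inp : X -> seq bits) k (h : X -> Y)
    (e1 e2 : Y -> bits) out :
  (forall x, size (inp x) = k.+1) -> polytime (fun y => [:: e1 y; e2 y]) out ->
  polytime inp (fun x => e1 (h x)) -> polytime inp (fun x => e2 (h x)) ->
  polytime inp (fun x => out (h x)).
Proof.
move=> size_inp pout pe1 pe2.
pose gs := [:: fun x => e1 (h x); fun x => e2 (h x)].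
apply: (polytime_comp (gs := gs) size_inp) => [g [<-|[<-|//]] //|].
by apply: polytime_restrict pout => x; exists (h x).
Qed.

(** * Codes of numbers *)

Definition enc_nats (vs : seq nat) : bits := flatten (map unary vs).

Definition tuples_below (n k : nat) (ts : seq (seq nat)) : bool :=
  all (fun t => (size t == k) && all (gtn n) t) ts.

Definition enc_nat_tuples (ts : seq (seq nat)) : bits :=
  rcons (flatten [seq true :: enc_nats t | t <- ts]) false.

Lemma size_unary n : size (unary n) = n.+1.
Proof. by rewrite size_rcons size_nseq. Qed.

Lemma enc_nats_cons v vs : enc_nats (v :: vs) = unary v ++ enc_nats vs.
Proof. by []. Qed.

Lemma enc_nats_cat us vs : enc_nats (us ++ vs) = enc_nats us ++ enc_nats vs.
Proof. by rewrite /enc_nats map_cat flatten_cat. Qed.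

Lemma enc_ordsE n (t : seq 'I_n) : enc_ords t = enc_nats (map val t).
Proof. by rewrite /enc_nats -map_comp. Qed.

Lemma size_enc_ords n (t : seq 'I_n) : size (enc_ords t) <= size t * n.
Proof.
elim: t => [|i t IH] //=; rewrite /enc_ords /= size_cat size_unary mulSn.
by rewrite leq_add.
Qed.

Lemma enc_tuplesE n k (ts : seq (k.-tuple 'I_n)) :
  enc_tuples ts = enc_nat_tuples [seq map val (val t) | t <- ts].
Proof.
rewrite /enc_tuples /enc_nat_tuples -map_comp; congr (rcons (flatten _) _).
by apply: eq_map => t /=; rewrite enc_ordsE.
Qed.

(* The boolean tells whether a code of a number below [b] could be removed. *)
Fixpoint strip_code (b : nat) (y : bits) : bool * bits :=
  match b, y with
  | b'.+1, true :: y' => strip_code b' y'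
  | _.+1, false :: y' => (true, y')
  | _, _ => (false, y)
  end.

Fixpoint strip_codes (b n : nat) (y : bits) : bool * bits :=
  if n is n'.+1 then
    let: (ok, y') := strip_code b y in
    if ok then strip_codes b n' y' else (false, y')
  else (true, y).

Lemma strip_codeP b y y' :
  strip_code b y = (true, y') <-> exists2 v, v < b & y = unary v ++ y'.
Proof.
elim: b y => [|b IH] [|[] y]; try by split=> // -[[|v]].
- split=> [/IH [v lt_v ->]|[[|v] // lt_v [yE]]]; first by exists v.+1.
  by apply/IH; exists v.
- by split=> [[<-]|[[|v] // _ [<-]]] //; exists 0.
Qed.

Lemma strip_codesP b n y y' :
  strip_codes b n y = (true, y') <->
  exists t : n.-tuple 'I_b, y = enc_ords t ++ y'.
Proof.
elim: n y => [|n IH] y /=.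
  by split=> [[->]|[t ->]]; [exists [tuple] | rewrite tuple0].
split=> [|[t ->]].
  case strip_y: (strip_code b y) => [[] y1] // /IH [t yE].
  have /strip_codeP [v lt_v ->] := strip_y; exists [tuple of Ordinal lt_v :: t].
  by rewrite yE catA.
case/tupleP: t => v t; rewrite /enc_ords /= -catA.
have /strip_codeP -> : exists2 w, w < b & unary v ++ enc_ords t ++ y' =
    unary w ++ enc_ords t ++ y' by exists v.
by apply/IH; exists t.
Qed.

(** * Checking a homomorphism *)

(* The four tapes hold the unread part of the instance, the unread part of the
   candidate assignment, its part already read (in reverse order), and one bit
   for each violation found. *)
Definition quad (T : Type) (e y z f : T) (v : bool * bool) : T :=
  match v with
  | (false, false) => e
  | (false, true) => y
  | (true, false) => z
  | (true, true) => f
  end.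

Notation instance_tape := (false, false).
Notation unread_tape := (false, true).
Notation read_tape := (true, false).
Notation violation_tape := (true, true).
Notation checker := (frag (prod bool bool)).
Notation store e y z c := (quad e y z (nseq c true)).

Definition checker_ops (o1 o2 o3 o4 : op) : checker := fops (quad o1 o2 o3 o4).

Lemma sexec_checker_ops o1 o2 o3 o4 e y z f :
  sexec (checker_ops o1 o2 o3 o4) (quad e y z f) 2
        (quad (bits_op o1 e) (bits_op o2 y) (bits_op o3 z) (bits_op o4 f)).
Proof.
have -> : quad (bits_op o1 e) (bits_op o2 y) (bits_op o3 z) (bits_op o4 f) =
    fun v => bits_op (quad o1 o2 o3 o4 v) (quad e y z f v).
  by apply: functional_extensionality => -[[] []].
exact: sexec_ops.
Qed.

Definition checker_skip : checker := checker_ops Keep Keep Keep Keep.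
Definition report_violation : checker := checker_ops Keep Keep Keep (Push true).
Definition pop_instance : checker := checker_ops Pop Keep Keep Keep.
Definition read_bit (a : bool) : checker := checker_ops Keep Pop (Push a) Keep.
Definition rewind : checker := fmove read_tape (pred1 unread_tape).
Definition answer (a : bool) : checker := fwrite instance_tape [:: a].

Lemma sexec_rewind e y z c :
  sexec rewind (store e y z c) (4 * size z + 1) (store e (catrev z y) [::] c).
Proof.
have := @sexec_move _ read_tape (pred1 unread_tape) (store e y z c).
rewrite /sexec; congr exec; apply: functional_extensionality.
by move=> [[] []].
Qed.

Lemma sexec_answer a e y z c :
  sexec (answer a) (store e y z c) (4 * size e + 3) (store [:: a] y z c).
Proof.
have := @sexec_write _ instance_tape [:: a] (store e y z c).
rewrite /sexec /= -addnA; congr exec; apply: functional_extensionality.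
by move=> [[] []].
Qed.

Definition skip_code : checker :=
  fseq (fwhile (fun r => r unread_tape == Some true) (read_bit true))
       (read_bit false).

Lemma sexec_skip_code v e y z c :
  sexec skip_code (store e (unary v ++ y) z c) (3 * v + 3)
        (store e y (catrev (unary v) z) c).
Proof.
have -> : 3 * v + 3 = (3 * v + 1) + 2 by lia.
apply: (@exec_seq _ _ _ _
  (stacks (store e (false :: y) (catrev (nseq v true) z) c))).
  elim: v z => [|v IH] z; first exact: sexec_while_done.
  have -> : 3 * v.+1 + 1 = (2 + (3 * v + 1)).+1 by lia.
  by apply: sexec_while_more (IH _) => //; apply: sexec_checker_ops.
have -> : catrev (unary v) z = false :: catrev (nseq v true) z.
  by rewrite /unary -cats1 catrev_catl.
exact: sexec_checker_ops.
Qed.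

Definition skip_codes : checker :=
  fwhile (fun r => r instance_tape == Some true) (fseq pop_instance skip_code).

Lemma sexec_skip_codes us e y z c :
  sexec skip_codes (store (unary (size us) ++ e) (enc_nats us ++ y) z c)
        (3 * size (enc_nats us) + 3 * size us + 1)
        (store (false :: e) y (catrev (enc_nats us) z) c).
Proof.
elim: us z => [|u us IH] z; first exact: sexec_while_done.
rewrite enc_nats_cons size_cat size_unary catrev_catl -catA.
apply: (@exec_leq _ _ _ _ ((2 + (3 * u + 3)) +
  (3 * size (enc_nats us) + 3 * size us + 1)).+1); first by rewrite /=; lia.
apply: sexec_while_more (IH _) => //.
by apply: exec_seq (sexec_skip_code _ _ _ _ _); apply: sexec_checker_ops.
Qed.

(* The number read, below [fuel], is kept in the control state: [k] selects the
   continuation. *)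
Fixpoint read_code (k : nat -> checker) (fuel j : nat) : checker :=
  if fuel is fuel'.+1 then
    fif (fun r => r unread_tape == Some true)
        (fseq (read_bit true) (read_code k fuel' j.+1))
        (fif (fun r => r unread_tape == Some false)
             (fseq (read_bit false) (k j)) report_violation)
  else report_violation.

Lemma sexec_read_code k fuel j v e y z c n s : v < fuel ->
  sexec (k (j + v)) (store e y (catrev (unary v) z) c) n s ->
  sexec (read_code k fuel j) (store e (unary v ++ y) z c) (3 * v + 4 + n) s.
Proof.
elim: fuel j v z => [|fuel IH] j [|v] z //= lt_v ex_k.
  have -> : 3 * 0 + 4 + n = (2 + n).+2 by lia.
  do 2 apply: sexec_if => /=; apply: exec_seq; first exact: sexec_checker_ops.
  by rewrite addn0 in ex_k.
have -> : 3 * v.+1 + 4 + n = (2 + (3 * v + 4 + n)).+1 by lia.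
apply: sexec_if => /=; apply: exec_seq; first exact: sexec_checker_ops.
by apply: IH => //; rewrite addSnnS.
Qed.

Lemma sexec_read_code_strip fuel j e y z c :
  let: (ok, y') := strip_code fuel y in
  exists z', sexec (read_code (fun=> checker_skip) fuel j) (store e y z c)
                   (3 * fuel + 4) (store e y' z' (~~ ok + c)).
Proof.
elim: fuel j y z => [|fuel IH] j y z.
  by exists z; apply: exec_leq (sexec_checker_ops _ _ _ _ _ _ _ _).
case: y => [|[] y] /=.
- exists z; apply: (@exec_leq _ _ _ _ 4); first by lia.
  by do 2 apply: sexec_if => /=; apply: sexec_checker_ops.
- have := IH j.+1 y (true :: z); case: strip_code => ok y' [z' ex_read].
  exists z'; have -> : 3 * fuel.+1 + 4 = (2 + (3 * fuel + 4)).+1 by lia.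
  by apply: sexec_if => /=; apply: exec_seq ex_read; apply: sexec_checker_ops.
- exists (false :: z); apply: (@exec_leq _ _ _ _ (2 + 2).+2); first by lia.
  by do 2 apply: sexec_if => /=; apply: exec_seq; apply: sexec_checker_ops.
Qed.

Section Checkers.

Variable b : nat.

Definition read_codes : checker :=
  fwhile (fun r => (r instance_tape == Some true) && (r violation_tape == None))
         (fseq pop_instance (read_code (fun=> checker_skip) b 0)).

Lemma sexec_read_codes n e y z :
  let: (ok, y') := strip_codes b n y in
  exists e' z', size e' <= size (unary n ++ e) /\
    sexec read_codes (store (unary n ++ e) y z 0) ((3 * b + 7) * n + 1)
          (store e' y' z' (~~ ok)).
Proof.
elim: n y z => [|n IH] y z /=.
  by exists (false :: e), z; rewrite muln0; split=> //; apply: sexec_while_done.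
have := sexec_read_code_strip b 0 (unary n ++ e) y z 0.
case: (strip_code b y) => -[] y1 [z1 ex_read].
- have := IH y1 z1.
  case: (strip_codes b n y1) => ok y2 [e' [z' [size_e' ex_rest]]].
  exists e', z'; split; first exact: leqW.
  have -> : (3 * b + 7) * n.+1 + 1 =
      (2 + (3 * b + 4) + ((3 * b + 7) * n + 1)).+1 by lia.
  apply: sexec_while_more ex_rest => //.
  by apply: exec_seq ex_read; apply: sexec_checker_ops.
- exists (unary n ++ e), z1; split; first exact: leqnSn.
  apply: (@exec_leq _ _ _ _ (2 + (3 * b + 4) + 1).+1); first by lia.
  apply: sexec_while_more (sexec_while_done _ _) => //=; last by rewrite andbF.
  by apply: exec_seq ex_read; apply: sexec_checker_ops.
Qed.

Lemma polytime_assignment_check :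
  polytime (fun x : nat * bits * bits => [:: unary x.1.1 ++ x.1.2; x.2])
    (fun x => enc_bool [exists t : (x.1.1).-tuple 'I_b, x.2 == enc_ords t]).
Proof.
pose F := fseq read_codes
  (fif (fun r => (r violation_tape == None) && (r unread_tape == None))
       (answer true) (answer false)).
apply: (@frag_polytime _ _ _ _ F
  (fun x => store (unary x.1.1 ++ x.1.2) x.2 [::] 0) instance_tape
  [:: unread_tape] (fun n => ((3 * b + 7) * n + 1) + (4 * n + 4))) => //.
- by move=> x [[] []].
- by poly_bound.
move=> [[n e] y] /=; set N := size _ + _.
have okE : [exists t : n.-tuple 'I_b, y == enc_ords t] =
    (strip_codes b n y == (true, [::])).
  apply/existsP/eqP => [[t /eqP yE]|/strip_codesP [t yE]].
    by apply/strip_codesP; exists t; rewrite cats0.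
  by exists t; rewrite yE cats0.
have := sexec_read_codes n e y [::]; rewrite okE.
case: (strip_codes b n y) => ok y' [e' [z' [size_e' ex_read]]].
set a := _ == _; exists (stacks (store [:: a] y' z' (~~ ok))).
  apply: (@exec_seq _ _ _ _ (stacks (store e' y' z' (~~ ok)))).
    apply: exec_leq ex_read; rewrite leq_add2r leq_mul2l.
    by rewrite /N size_cat size_unary; lia.
  apply: (@exec_leq _ _ _ _ (4 * size e' + 3).+1); first by rewrite /N; lia.
  apply: sexec_if; rewrite /= (_ : _ && _ = a).
    by case: a; apply: sexec_answer.
  by rewrite /a xpair_eqE; case: (ok); case: (y') => [|[]].
exact: shows_stack.
Qed.

Definition lookup (k : nat -> checker) : checker :=
  fseq skip_codes
       (fseq pop_instance (read_code (fun v => fseq rewind (k v)) b 0)).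

Lemma sexec_lookup k vs i e c n s : i < size vs -> all (gtn b) vs ->
  sexec (k (nth 0 vs i)) (store e (enc_nats vs) [::] c) n s ->
  sexec (lookup k) (store (unary i ++ e) (enc_nats vs) [::] c)
        ((7 * size (enc_nats vs) + 8) * size (unary i) + n) s.
Proof.
move=> lt_i vs_b ex_k; set v := nth 0 vs i in ex_k.
have vsE : enc_nats vs =
    enc_nats (take i vs) ++ unary v ++ enc_nats (drop i.+1 vs).
  by rewrite -{1}(cat_take_drop i vs) (drop_nth 0) // enc_nats_cat.
have size_take : size (take i vs) = i by rewrite size_takel // ltnW.
rewrite size_unary; have /(congr1 size) := vsE; rewrite !size_cat size_unary.
move=> size_vs; set S := size (enc_nats vs) in size_vs *.
apply: (@exec_leq _ _ _ _ ((3 * size (enc_nats (take i vs)) + 3 * i + 1) +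
  (2 + (3 * v + 4 + ((4 * S + 1) + n))))); first by lia.
have ex_skip := sexec_skip_codes (take i vs) e
  (unary v ++ enc_nats (drop i.+1 vs)) [::] c.
rewrite size_take -vsE in ex_skip.
apply: exec_seq ex_skip _; apply: exec_seq; first exact: sexec_checker_ops.
apply: sexec_read_code; first exact: (allP vs_b _ (mem_nth 0 lt_i)).
apply: exec_seq ex_k; rewrite /= -catrev_catl.
set z := catrev _ _.
have <- : catrev z (enc_nats (drop i.+1 vs)) = enc_nats vs.
  by rewrite /z !catrevE cats0 revK vsE catA.
apply: exec_leq (sexec_rewind _ _ _ _).
by rewrite /z catrevE cats0 size_rev size_cat size_unary; lia.
Qed.

Fixpoint check_tuple (P : pred (seq nat)) (k : nat) (acc : seq nat) : checker :=
  if k is k'.+1 then lookup (fun v => check_tuple P k' (rcons acc v))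
  else if P acc then checker_skip else report_violation.

Lemma sexec_check_tuple P vs t acc e c :
  all (gtn (size vs)) t -> all (gtn b) vs ->
  sexec (check_tuple P (size t) acc)
        (store (enc_nats t ++ e) (enc_nats vs) [::] c)
        ((7 * size (enc_nats vs) + 8) * size (enc_nats t) + 2)
        (store e (enc_nats vs) [::] (~~ P (acc ++ map (nth 0 vs) t) + c)).
Proof.
move=> + vs_b; elim: t acc => [|i t IH] acc.
  by move=> _; rewrite cats0 muln0 /=; case: (P acc); apply: sexec_checker_ops.
case/andP=> lt_i t_lt; rewrite enc_nats_cons size_cat mulnDr -catA -addnA.
by apply: sexec_lookup => //; rewrite -cat_rcons; apply: IH.
Qed.

Definition check_tuples (P : pred (seq nat)) (k : nat) : checker :=
  fseq (fwhile (fun r => r instance_tape == Some true)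
               (fseq pop_instance (check_tuple P k [::])))
       pop_instance.

Definition violations (P : pred (seq nat)) (vs : seq nat) (ts : seq (seq nat)) :
    nat :=
  count (fun t => ~~ P (map (nth 0 vs) t)) ts.

Lemma sexec_check_tuples P k vs ts e c :
  tuples_below (size vs) k ts -> all (gtn b) vs ->
  sexec (check_tuples P k)
        (store (enc_nat_tuples ts ++ e) (enc_nats vs) [::] c)
        ((7 * size (enc_nats vs) + 8) * size (enc_nat_tuples ts))
        (store e (enc_nats vs) [::] (violations P vs ts + c)).
Proof.
move=> ts_ok vs_b; set D := 7 * _ + 8; rewrite size_rcons mulnS addnC.
apply: (@exec_leq _ _ _ _
  ((D * size (flatten [seq true :: enc_nats t | t <- ts]) + 1) + 2)).
  by rewrite /D; lia.
apply: exec_seq (sexec_checker_ops _ _ _ _ (false :: e) _ _ _).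
elim: ts c ts_ok => [|t ts IH] c /=.
  by rewrite muln0 => _; apply: sexec_while_done.
case/andP=> /andP [/eqP size_t t_lt] /IH {}IH.
apply: (@exec_leq _ _ _ _ ((2 + (D * size (enc_nats t) + 2)) +
  (D * size (flatten [seq true :: enc_nats t | t <- ts]) + 1)).+1).
  by rewrite size_cat /D; lia.
have -> : violations P vs (t :: ts) + c =
    violations P vs ts + (~~ P (map (nth 0 vs) t) + c).
  by rewrite /violations /=; lia.
apply: sexec_while_more (IH _) => //.
apply: exec_seq; first exact: sexec_checker_ops.
rewrite -size_t /enc_nat_tuples /= rcons_cat -catA; exact: sexec_check_tuple.
Qed.

Section Relations.

Variables (S : Type) (P : S -> pred (seq nat)) (k : S -> nat).
Variable ts : S -> seq (seq nat).

Let enc_rels ss := flatten [seq enc_nat_tuples (ts s) | s <- ss].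

Definition check_relations (ss : seq S) : checker :=
  foldr (fun s => fseq (check_tuples (P s) (k s))) checker_skip ss.

Lemma sexec_check_relations ss vs c :
  (forall s, tuples_below (size vs) (k s) (ts s)) ->
  all (gtn b) vs ->
  sexec (check_relations ss) (store (enc_rels ss) (enc_nats vs) [::] c)
    ((7 * size (enc_nats vs) + 8) * size (enc_rels ss) + 2)
    (store [::] (enc_nats vs) [::]
       (\sum_(s <- ss) violations (P s) vs (ts s) + c)).
Proof.
move=> ts_ok vs_b; elim: ss c => [|s ss IH] c.
  by rewrite big_nil muln0; apply: sexec_checker_ops.
rewrite /enc_rels /= size_cat mulnDr -addnA big_cons.
rewrite [violations _ _ _ + _]addnC -(addnA (\sum_(j <- ss) _)).
exact: exec_seq (sexec_check_tuples _ _ _ (ts_ok s) vs_b) (IH _).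
Qed.

Definition check_instance (ss : seq S) : checker :=
  fseq (fwhile (fun r => r instance_tape == Some true) pop_instance)
 (fseq pop_instance
 (fseq (check_relations ss)
       (fif (fun r => r violation_tape == None) (answer true) (answer false)))).

Lemma sexec_check_instance n ss vs :
  (forall s, tuples_below (size vs) (k s) (ts s)) ->
  all (gtn b) vs ->
  let ok := all (fun s => all (fun t => P s (map (nth 0 vs) t)) (ts s)) ss in
  exists s', sexec (check_instance ss)
    (store (unary n ++ enc_rels ss) (enc_nats vs) [::] 0)
    (3 * n + (7 * size (enc_nats vs) + 8) * size (enc_rels ss) + 9) s' /\
    s' instance_tape = [:: ok].
Proof.
move=> ts_ok vs_b ok; pose c := \sum_(s <- ss) violations (P s) vs (ts s) + 0.
exists (store [:: ok] (enc_nats vs) [::] c); split=> //.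
set D := _ * size _.
have -> : 3 * n + D + 9 = (3 * n + 1) + (2 + ((D + 2) + 4)) by lia.
apply: (@exec_seq _ _ _ _
  (stacks (store (false :: enc_rels ss) (enc_nats vs) [::] 0))).
  elim: n => [|n IH]; first exact: sexec_while_done.
  have -> : 3 * n.+1 + 1 = (2 + (3 * n + 1)).+1 by lia.
  by apply: sexec_while_more IH => //; apply: sexec_checker_ops.
apply: exec_seq; first exact: sexec_checker_ops.
apply: exec_seq; first exact: (sexec_check_relations ss 0 ts_ok vs_b).
apply: sexec_if; rewrite /= -/c.
have -> : (ohead (nseq c true) == None) = ok.
  rewrite (_ : _ == None = (c == 0)) ?addn0; last by case: (c).
  rewrite /c addn0 sum_nat_seq_eq0; apply: eq_all => s /=.
  rewrite /violations -leqn0 leqNgt -has_count -all_predC.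
  by apply: eq_all => t /=; rewrite negbK.
by case: ok; apply: sexec_answer [::] _ _ _.
Qed.

End Relations.

End Checkers.

(** * Homomorphisms as certificates *)

Definition is_homb (sigma : signature) (A B : structure sigma)
    (h : dom A -> dom B) : bool :=
  [forall s, forall t : (arity s).-tuple (dom A),
    (t \in rel A s) ==> (map_tuple h t \in rel B s)].

Lemma is_homP (sigma : signature) (A B : structure sigma)
    (h : dom A -> dom B) : reflect (is_hom h) (is_homb h).
Proof.
apply: (iffP forallP) => [hom s t|hom s].
  by have /forallP /(_ t) /implyP := hom s.
by apply/forallP => t; apply/implyP; apply: hom.
Qed.

Section Assignments.

Variables (sigma : signature) (B : structure sigma).
Implicit Type I : input sigma.

Definition decode n (t : n.-tuple 'I_#|dom B|) (i : 'I_n) : dom B :=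
  enum_val (tnth t i).

Lemma enc_hom_decode I (t : (isize I).-tuple 'I_#|dom B|) :
  @enc_hom sigma I B (decode t) = enc_ords t.
Proof.
rewrite /enc_hom /decode -[in RHS](map_tnth_enum t); congr enc_ords.
by apply: eq_map => i; rewrite enum_valK.
Qed.

Lemma decode_surj n (h : 'I_n -> dom B) : exists t, decode t = h.
Proof.
exists [tuple enum_rank (h i) | i < n]; apply: functional_extensionality => i.
by rewrite /decode tnth_mktuple enum_rankK.
Qed.

Definition hom_check I (y : bits) : bool :=
  [exists t : (isize I).-tuple 'I_#|dom B|,
    (y == enc_ords t) && @is_homb sigma I B (decode t)].

Lemma hom_checkP I y :
  reflect (exists2 h : dom I -> dom B, is_hom h & y = enc_hom h)
          (hom_check I y).
Proof.
apply: (iffP existsP) => [[t /andP [/eqP -> /is_homP hom]]|[h]].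
  by exists (decode t); rewrite ?enc_hom_decode.
have [t <-] := decode_surj h => hom ->; exists t.
by rewrite enc_hom_decode eqxx; apply/is_homP.
Qed.

Lemma hom_check_enc_ords I (t : (isize I).-tuple 'I_#|dom B|) :
  hom_check I (enc_ords t) = @is_homb sigma I B (decode t).
Proof.
apply/existsP/idP => [[u /andP [/eqP tu hom]]|hom]; last first.
  by exists t; rewrite eqxx.
suff -> : t = u by [].
apply: val_inj; have [||tu_val _ //] := @enc_ords_cat_inj _ t u [::] [::].
  by rewrite !size_tuple.
by rewrite !cats0.
Qed.

Definition rank_tuple (s : symbol sigma) : pred (seq nat) :=
  fun ns => [exists t in rel B s, ns == [seq val (enum_rank x) | x <- val t]].

Lemma rank_tuple_decode n (t : n.-tuple 'I_#|dom B|) s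
    (u : (arity s).-tuple 'I_n) :
  rank_tuple s (map (nth 0 (map val t)) (map val u)) =
  (map_tuple (decode t) u \in rel B s).
Proof.
have -> : map (nth 0 (map val t)) (map val u) =
    [seq val (enum_rank x) | x <- map_tuple (decode t) u].
  rewrite -!map_comp; apply: eq_map => i /=.
  have [x0] : inhabited 'I_#|dom B| by exists; apply: tnth t i.
  by rewrite enum_valK (nth_map x0) ?size_tuple // -tnth_nth.
apply/exists_inP/idP => [[w wB /eqP uw]|tuB]; last first.
  by exists (map_tuple (decode t) u).
suff -> : map_tuple (decode t) u = w by [].
apply: val_inj; apply: (inj_map _ uw) => x y /val_inj; exact: enum_rank_inj.
Qed.

Definition input_tuples I (s : symbol sigma) : seq (seq nat) :=
  [seq map val (val u) | u <- enum (irel I s)].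

Lemma enc_inputE I : enc_input I = unary (isize I) ++
  flatten [seq enc_nat_tuples (input_tuples I s) | s <- enum (symbol sigma)].
Proof. by congr (_ ++ flatten _); apply: eq_map => s; apply: enc_tuplesE. Qed.

Lemma input_tuples_below I s :
  tuples_below (isize I) (arity s) (input_tuples I s).
Proof.
apply/allP => _ /mapP [u _ ->]; rewrite size_map size_tuple eqxx.
by apply/allP => _ /mapP [i _ ->] /=.
Qed.

Lemma is_homb_decode I (t : (isize I).-tuple 'I_#|dom B|) :
  @is_homb sigma I B (decode t) =
  all (fun s => all (fun u => rank_tuple s (map (nth 0 (map val t)) u))
                    (input_tuples I s)) (enum (symbol sigma)).
Proof.
apply/forallP/allP => [hom s _|hom s].
  apply/allP => _ /mapP [u uI ->]; rewrite rank_tuple_decode.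
  by have /forallP /(_ u) := hom s; rewrite mem_enum in uI; rewrite uI.
apply/forallP => u; apply/implyP => uI; rewrite -rank_tuple_decode.
have /allP := hom s (mem_enum _ s); apply.
apply: (map_f (fun u : (arity s).-tuple _ => map val (val u))).
by rewrite mem_enum.
Qed.

Lemma polytime_is_homb :
  polytime
    (fun It : {I : input sigma & (isize I).-tuple 'I_#|dom B|} =>
       [:: enc_input (tag It); enc_ords (tagged It)])
    (fun It => enc_bool (@is_homb sigma (tag It) B (decode (tagged It)))).
Proof.
pose F :=
  check_instance #|dom B| rank_tuple (@arity sigma) (enum (symbol sigma)).
pose s0 (It : {I : input sigma & (isize I).-tuple 'I_#|dom B|}) :=
  store (enc_input (tag It)) (enc_ords (tagged It)) [::] 0.
apply: (@frag_polytime _ _ _ _ F s0 instance_tape [:: unread_tape]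
  (fun n => 3 * n + (7 * n + 8) * n + 9)) => //.
- by move=> It [[] []].
- by poly_bound.
case=> I t /=; rewrite addn0 is_homb_decode.
have t_lt : all (gtn #|dom B|) (map val t).
  by apply/allP => _ /mapP [i _ ->] /=.
have [|s' [ex_s' s'_ok]] := sexec_check_instance rank_tuple (k := @arity sigma)
  (ts := input_tuples I) (isize I) (enum (symbol sigma)) _ t_lt.
  by move=> s; rewrite size_map size_tuple; apply: input_tuples_below.
exists (stacks s'); last by rewrite /stacks s'_ok; apply: shows_stack.
rewrite -enc_inputE -enc_ordsE in ex_s'; apply: exec_leq ex_s'.
have := congr1 size (enc_inputE I); rewrite size_cat size_unary => size_I.
set N := _ + size (enc_ords _).
have I_le_N : size (enc_input I) <= N by apply: leq_addr.
rewrite leq_add2r leq_add ?leq_mul ?leq_add2r ?leq_mul2l ?leq_addl //; lia.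
Qed.

Lemma polytime_hom_check :
  polytime (fun xy : input sigma * bits => [:: enc_input xy.1; xy.2])
           (fun xy => enc_bool (hom_check xy.1 xy.2)).
Proof.
pose is_assignment (xy : input sigma * bits) :=
  [exists t : (isize xy.1).-tuple 'I_#|dom B|, xy.2 == enc_ords t].
apply: (@polytime_if _ _ 1 _ (fun xy => enc_bool (is_assignment xy))
                     is_assignment) => [//|xy|||].
- by case: is_assignment.
- apply: polytime_restrict (polytime_assignment_check #|dom B|) => -[I y].
  exists (isize I, flatten [seq enc_nat_tuples (input_tuples I s)
                           | s <- enum (symbol sigma)], y) => //=.
  by rewrite enc_inputE.
- apply: polytime_restrict polytime_is_homb => -[[I y] /= y_ok].
  have /existsP [t /eqP /= ->] := y_ok.
  by exists (existT _ I t) => //=; rewrite hom_check_enc_ords.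
- apply: (@polytime_const _ _ 1 _ (enc_bool false)) => // -[[I y] yN] /=.
  congr enc_bool; apply/existsP => -[t /andP [yt _]].
  by case/existsP: yN; exists t.
Qed.

End Assignments.

Lemma size_enc_hom (sigma : signature) (I : input sigma) (B : structure sigma)
    (h : dom I -> dom B) :
  size (enc_hom h) <= size (enc_input I) * #|dom B|.
Proof.
apply: leq_trans (size_enc_ords _) _; rewrite size_map size_enum_ord.
by rewrite leq_mul2r /enc_input size_cat size_unary orbC leqW ?leq_addr.
Qed.

Lemma inFNP_sPCSP (sigma : signature) (T : template sigma) : inFNP (sPCSP T).
Proof.
exists (hom_check (tB T)), ('X * (#|dom (tB T)|)%:P)%R; split.
  exact: polytime_hom_check.
move=> I y; split=> [sol|[_ /hom_checkP] //]; split; last exact/hom_checkP.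
by case: sol => h _ ->; rewrite hornerM hornerX hornerC; apply: size_enc_hom.
Qed.

(** * Hard search problems with verifiable answers *)

(* The search counterpart of the intersection of NP and coNP: on every instance,
   some short valid answer, solution or rejection, can be verified. *)
Definition has_verifiable_answers (T : search_problem) : Prop :=
  exists (A : instance T -> option bits -> bool) (p : {poly nat}),
  [/\ polytime
        (fun xz : instance T * option bits => [:: enc xz.1; enc_option xz.2])
        (fun xz => enc_bool (A xz.1 xz.2)),
      forall x z, A x z -> valid x z
    & forall x, exists2 z, size (enc_option z) <= p.[size (enc x)]%R & A x z].

Definition dec_option (c : bits) : option bits :=
  if c is true :: y then Some y else None.

Lemma enc_optionK : cancel enc_option dec_option.
Proof. by case. Qed.

Lemma polytime_normalize_option :
  polytime (fun c => [:: c]) (fun c => enc_option (dec_option c)).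
Proof.
apply: (@polytime_if _ _ 0 _ id (fun c => dec_option c)) => //.
- by case=> [|[]].
- exact: polytime_id.
- apply: polytime_restrict polytime_id => -[[|[] y] //= _].
  by exists (true :: y).
- apply: (@polytime_const _ _ 0 _ [:: false]) => // -[c] /=.
  by case: (dec_option c).
Qed.

Lemma polytime_is_none :
  polytime (fun z : option bits => [:: enc_option z])
           (fun z => enc_bool (z == None)).
Proof.
apply: (@polytime_if _ _ 0 _ enc_option isSome) => // [[]//|||].
- by apply: polytime_restrict polytime_id => z; exists (enc_option z).
- by apply: (@polytime_const _ _ 0 _ (enc_bool false)) => // -[[]].
- by apply: (@polytime_const _ _ 0 _ (enc_bool true)) => // -[[]].
Qed.

Definition np_search (V : bits -> bits -> bool) (p : {poly nat}) :
    search_problem :=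
  @SearchProblem bits id (fun _ _ => id)
    (fun x => exists y, size y <= p.[size x]%R /\ V x y)
    (fun x y => size y <= p.[size x]%R /\ V x y) (fun _ => id).

Lemma inFNP_np_search V p :
  polytime (fun xy : bits * bits => [:: xy.1; xy.2])
           (fun xy => enc_bool (V xy.1 xy.2)) -> inFNP (np_search V p).
Proof. by move=> pV; exists V, p. Qed.

Lemma valid_np_search V p x z : @valid (np_search V p) x z ->
  z = None <-> ~ exists y, size y <= p.[size x]%R /\ V x y.
Proof.
case=> found rejected; split=> [zN /found [y]|unsolvable]; first by rewrite zN.
by apply: rejected => y sol; apply: unsolvable; exists y.
Qed.

Definition rejection_certificate (T : search_problem)
    (A : instance T -> option bits -> bool) (alpha : bits -> instance T)
    (beta : bits -> option bits -> option bits) (x c : bits) : bool :=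
  A (alpha x) (dec_option c) && (beta x (dec_option c) == None).

Lemma polytime_rejection_certificate (T : search_problem)
    (A : instance T -> option bits -> bool) (alpha : bits -> instance T)
    (beta : bits -> option bits -> option bits) :
  polytime (fun xz : instance T * option bits => [:: enc xz.1; enc_option xz.2])
           (fun xz => enc_bool (A xz.1 xz.2)) ->
  polytime (fun x => [:: x]) (fun x => enc (alpha x)) ->
  polytime (fun xz : bits * option bits => [:: xz.1; enc_option xz.2])
           (fun xz => enc_option (beta xz.1 xz.2)) ->
  polytime (fun xc : bits * bits => [:: xc.1; xc.2])
    (fun xc => enc_bool (rejection_certificate A alpha beta xc.1 xc.2)).
Proof.
move=> pA palpha pbeta; set inp := fun xc : bits * bits => _.
have size2 xc : size (inp xc) = 2 by [].
have px : polytime inp fst := polytime_nth 0 size2.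
have pz : polytime inp (fun xc => enc_option (dec_option xc.2)).
  exact: polytime_comp1 size2 polytime_normalize_option (polytime_nth 1 size2).
have palpha_x : polytime inp (fun xc => enc (alpha xc.1)).
  exact: polytime_comp1 size2 palpha px.
have pbeta_z : polytime inp
    (fun xc => enc_option (beta xc.1 (dec_option xc.2))).
  exact: (polytime_comp2 (h := fun xc : bits * bits => (xc.1, dec_option xc.2))
            size2 pbeta px pz).
apply: polytime_andb => //.
- exact: (polytime_comp2 (h := fun xc : bits * bits =>
            (alpha xc.1, dec_option xc.2)) size2 pA palpha_x pz).
- exact: (polytime_comp1 (h := fun xc : bits * bits =>
            beta xc.1 (dec_option xc.2)) size2 polytime_is_none pbeta_z).
Qed.

Lemma verifiable_hard_incoNP (T : search_problem) :
  has_verifiable_answers T -> FNP_hard T -> forall L, inNP L -> incoNP L.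
Proof.
case=> A [q [pA A_valid A_exists]] hard L [V [p [pV LV]]].
have [alpha [beta [palpha pbeta red]]] := hard _ (inFNP_np_search p pV).
have [r alpha_r] := polytime_size palpha.
have rejects_iff x z : A (alpha x) z -> (beta x z == None) <-> ~ L x.
  move=> /A_valid /red /valid_np_search rejects; rewrite LV -rejects.
  by split=> /eqP.
exists (rejection_certificate A alpha beta), (q \Po r)%R; split.
  exact: polytime_rejection_certificate.
move=> x; split=> [xNL|[c [_ /andP [Ac]]]]; last by rewrite rejects_iff.
have [z size_z Az] := A_exists (alpha x).
exists (enc_option z); split; last first.
  by rewrite /rejection_certificate enc_optionK Az /= rejects_iff.
rewrite horner_comp; apply: leq_trans size_z (horner_nat_leq _ _).
by have := alpha_r x; rewrite /= addn0.
Qed.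

Definition answer_check (sigma : signature) (B : structure sigma)
    (f : input sigma -> bool) (I : input sigma) (z : option bits) : bool :=
  if z is Some y then hom_check B I y else ~~ f I.

Lemma polytime_answer_check (sigma : signature) (B : structure sigma) f :
  polytime (fun I : input sigma => [:: enc_input I])
           (fun I => enc_bool (f I)) ->
  polytime (fun Iz : input sigma * option bits =>
              [:: enc_input Iz.1; enc_option Iz.2])
           (fun Iz => enc_bool (answer_check B f Iz.1 Iz.2)).
Proof.
move=> pf; set inp := fun Iz : input sigma * option bits => _.
have size2 Iz : size (inp Iz) = 2 by [].
have pI : polytime inp (fun Iz => enc_input Iz.1) := polytime_nth 0 size2.
have pz : polytime inp (fun Iz => enc_option Iz.2) := polytime_nth 1 size2.
have py : polytime inp (fun Iz => behead (enc_option Iz.2)).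
  exact: polytime_comp1 size2 polytime_behead pz.
have phom : polytime inp
    (fun Iz => enc_bool (hom_check B Iz.1 (behead (enc_option Iz.2)))).
  exact: (polytime_comp2 (h := fun Iz : input sigma * option bits =>
            (Iz.1, behead (enc_option Iz.2)))
            size2 (polytime_hom_check B) pI py).
have pNf : polytime inp (fun Iz => enc_bool (~~ f Iz.1)).
  exact: polytime_negb (polytime_comp1 size2 pf pI).
apply: (polytime_if (b := fun Iz => Iz.2) size2 _ pz) => [[I []//]||].
- by apply: polytime_restrict phom => -[[I [y|//]] ?]; exists (I, Some y).
- by apply: polytime_restrict pNf => -[[I [//|]] ?]; exists (I, None).
Qed.

Lemma sPCSP_verifiable (sigma : signature) (T : template sigma) :
  PCSP_polytime T -> has_verifiable_answers (sPCSP T).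
Proof.
case=> f [pf fP].
exists (answer_check (tB T) f), ('X * (#|dom (tB T)|)%:P + 1)%R; split.
- exact: polytime_answer_check pf.
- move=> I [y /hom_checkP sol|/negP fI].
    by split=> [_|/(_ y)//]; exists y.
  by split=> // /(proj1 (fP I)).
move=> I; have [[h hom]|/(proj2 (fP I)) fI] := classic (hom_to I (tB T)).
  exists (Some (enc_hom h)); last by apply/hom_checkP; exists h.
  rewrite hornerD hornerM hornerX !hornerC /= -addn1; apply: leq_add => //.
  exact: size_enc_hom.
exists None; last by rewrite /answer_check fI.
by rewrite hornerD hornerC; apply: leq_addl.
Qed.

Theorem theorem9p1 (sigma : signature) (T : template sigma)
    (polyPCSP : PCSP_polytime T) (NPcoNP : NP_neq_coNP) :
  ~ FNP_hard (sPCSP T) /\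
  (~ polytime_solvable (sPCSP T) -> FNP_intermediate (sPCSP T)).
Proof.
suff not_hard : ~ FNP_hard (sPCSP T).
  by split=> // unsolvable; split=> //; apply: inFNP_sPCSP.
move=> hard; apply: NPcoNP => L.
have NP_coNP := verifiable_hard_incoNP (sPCSP_verifiable polyPCSP) hard.
split; first exact: NP_coNP.
case/NP_coNP => V [p [pV LV]]; exists V, p; split=> // x.
by rewrite -LV; split=> [Lx /(_ Lx)|/NNPP].
Qed.
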